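(* Let $m\ge1$ be an integer, let $f(z)=\sum_{k=0}^\infty a_kz^k\in H^\infty(\mathbb{D})$ and $g(z)=\sum_{k=0}^\infty d_kz^k\in L^2_a(\mathbb{D})$. Write $g=g_0+g_1=g_0+z^mg_2$, where $g_0(z)=\sum_{k=0}^{m-1}d_kz^k$. The following equations are equivalent: (1) $T_{\overline{z}^m+f}\,g=0$; (2) $\big[zg_1'-(m-1)g_1\big]+(m+1)z^m(fg)+z^{m+1}(fg)'=0$; (3) $\big(zg_2'+g_2\big)+(m+1)(fg)+z(fg)'=0$; (4) $d_{m+k}=-\dfrac{m+1+k}{k+1}\sum_{i=0}^ka_{k-i}d_i$ for $k=0,1,2,\dots$.
   Context: $\mathbb{D}$ is the open unit disk in $\mathbb{C}$ and $dA$ is the normalized Lebesgue area measure on $\mathbb{D}$. The Bergman space $L^2_a(\mathbb{D})$ is the closed subspace of analytic functions in $L^2(\mathbb{D},dA)$, and $P:L^2(\mathbb{D},dA)\to L^2_a(\mathbb{D})$ is the orthogonal projection. For $\varphi\in L^\infty(\mathbb{D},dA)$ the Toeplitz operator is $T_\varphi h=P(\varphi h)$ on $L^2_a(\mathbb{D})$. $H^\infty(\mathbb{D})$ is the space of bounded analytic functions on $\mathbb{D}$. *)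

(* Defs.v *)
From HB Require Import structures.
From mathcomp Require Import all_boot all_order all_algebra.
From mathcomp Require Import complex.
From mathcomp Require Import all_classical all_reals all_analysis.

Set Implicit Arguments.
Unset Strict Implicit.
Unset Printing Implicit Defensive.

Import Order.TTheory GRing.Theory Num.Theory numFieldNormedType.Exports.

Local Open Scope classical_set_scope.
Local Open Scope complex_scope.
Local Open Scope ring_scope.

Section Defs.
Variable R : realType.

(* The complex numbers R[i] get their topology through the regular module
   R[i]^o, hence the casts below. *)

Definition disk : set R[i] := [set z | `|z| < 1].

(* sum_k (c k) z^k converges, with sum l *)
Definition power_sum (c : nat -> R[i]) (z l : R[i]) : Prop :=
  (series (fun k => c k * z ^+ k) : nat -> R[i]^o) @ \oo --> (l : R[i]^o).

Definition analytic_at (f : R[i] -> R[i]) (z0 : R[i]) : Prop :=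
  exists (c : nat -> R[i]) (r : R), 0 < r /\
    forall z, `|z - z0| < r%:C -> power_sum c (z - z0) (f z).

Definition analytic_on (D : set R[i]) (f : R[i] -> R[i]) : Prop :=
  forall z, D z -> analytic_at f z.

Definition cderiv (f : R[i] -> R[i]) (z : R[i]) : R[i] :=
  derive1 (f : R[i]^o -> R[i]^o) z.

Definition Hinfty (f : R[i] -> R[i]) : Prop :=
  analytic_on disk f /\ exists M : R, forall z, disk z -> `|f z| <= M%:C.

(* R[i] carries no measurable structure in the library: area integrals are
   taken over R * R, identified with R[i] through [toC]. *)
Local Notation plane := (measurableTypeR R * measurableTypeR R)%type.

Definition toC (p : plane) : R[i] := p.1 +i* p.2.

Definition pdisk : set plane := toC @^-1` disk.

Lemma invpi_ge0 : 0 <= (pi : R)^-1.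
Proof. by rewrite invr_ge0 pi_ge0. Qed.

Definition dA : {measure set plane -> \bar R} :=
  mscale (NngNum invpi_ge0) (lebesgue_measure \x lebesgue_measure)%E.

Definition L2 (u : R[i] -> R[i]) : Prop :=
  [/\ measurable_fun pdisk (fun p => complex.Re (u (toC p))),
      measurable_fun pdisk (fun p => complex.Im (u (toC p))) &
      (\int[dA]_(p in pdisk) ((Normc.normc (u (toC p))) ^+ 2)%:E < +oo)%E].

Definition cintegral (u : R[i] -> R[i]) : R[i] :=
  (\int[dA]_(p in pdisk) complex.Re (u (toC p)))
    +i* (\int[dA]_(p in pdisk) complex.Im (u (toC p))).

Definition inner (u v : R[i] -> R[i]) : R[i] :=
  cintegral (fun z => u z * (v z)^*).

Definition bergman (h : R[i] -> R[i]) : Prop := analytic_on disk h /\ L2 h.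

(* The orthogonal projection of L2 onto the closed subspace [bergman]. For u in
   L2 the specified h exists and is unique as a function on the disk; its values
   off the disk, and the default used for u not in L2, carry no meaning. *)
Definition bergman_proj (u : R[i] -> R[i]) : R[i] -> R[i] :=
  xget (fun=> 0) [set h | bergman h /\
    forall k, bergman k -> inner (fun z => u z - h z) k = 0].

Definition toeplitz (phi h : R[i] -> R[i]) : R[i] -> R[i] :=
  bergman_proj (fun z => phi z * h z).

End Defs.

Arguments disk {R}.

(* Main.v *)
Require Import Defs.
From HB Require Import structures.
From mathcomp Require Import all_boot all_order all_algebra.
From mathcomp Require Import complex ring lra.
From mathcomp Require Import all_classical all_reals all_analysis measurable_realfun.

(* The coefficient formula for the projection gives, on the disk,
     T g = f g + h0,   h0(z) = sum_k (k+1)/(m+k+1) d_{m+k} z^k,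
   after which (1)-(4) all say that the coefficients of one power series vanish.
   That h0 is the projection of conj(z)^m g is shown without Taylor's theorem for
   the test function k: if G' = g and H' = h0 (with G(0) = H(0) = 0), then on the
   circle |z| = r the function z^m conj(G) - r^(2m) conj(H) agrees with a
   polynomial p(z), so that k (z^m conj(G) - r^(2m) conj(H) - p) vanishes there.
   Its d-bar derivative k (z^m conj(g) - r^(2m) conj(h0)) therefore has integral 0
   over |z| < r, by Fubini and the fundamental theorem of calculus in x and in y.
   With k = h0 this bounds h0 in L^2; letting r tend to 1 gives orthogonality. *)

(** [analytic_on] provides only local expansions, so a test function [k] is not known to be one
    power series on the whole disk. Orthogonality is therefore proved for every [k] at once, by an
    identity in which [k] enters only through its d-bar derivative being 0. On |z| = r the relation
    z conj(z) = r^2 turns z^m conj(z)^n into r^(2m) conj(z)^(n-m) if n >= m, and into r^(2n) z^(m-n)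
    if n <= m; the finitely many terms of the second kind are holomorphic and make up p. Passing to
    primitives creates the quotient (k+1)/(m+k+1): integrating g divides d_{m+k} by m+k+1, lowering
    the degree by m leaves z^(k+1), and differentiating multiplies by k+1. The pairing of [k] with
    h0 over the full disk makes sense only once h0 is in L^2. For this reason everything is first
    done over |z| < r with r < 1, where all integrands are bounded, and the square-integrability of
    h0 is itself extracted from the identity. *)

Set Implicit Arguments.
Unset Strict Implicit.
Unset Printing Implicit Defensive.

Import Order.TTheory GRing.Theory Num.Theory numFieldNormedType.Exports.

Local Open Scope classical_set_scope.
Local Open Scope complex_scope.
Local Open Scope ring_scope.

(** * Modulus and convergence in R[i] *)

Section ComplexNorm.
Variable R : realType.
Local Notation C := R[i].
Local Notation N := (@Normc.normc R).
Local Notation re := (@complex.Re R).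
Local Notation im := (@complex.Im R).
Implicit Types (z w l : C).

Lemma norm_normcE z : `|z| = (N z)%:C. Proof. by []. Qed.

Lemma diskP z : disk z <-> N z < 1.
Proof. by rewrite /disk /= norm_normcE (_ : 1 = (1:R)%:C) // ltcR. Qed.

Lemma normc_ge0 z : 0 <= N z.
Proof. by case: z => a b; rewrite sqrtr_ge0. Qed.

Lemma norm_sub0_normc z : `|0 - N z| = N z.
Proof. by rewrite sub0r normrN ger0_norm ?normc_ge0. Qed.
Lemma normc_0 : N 0 = 0. Proof. exact: Normc.normc0. Qed.
Lemma normc_1 : N 1 = 1. Proof. exact: Normc.normc1. Qed.
Lemma le_normcB z w : N (z - w) <= N z + N w.
Proof. by rewrite -(normcN w) le_normcD. Qed.
Lemma normc_distC z w : N (z - w) = N (w - z).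
Proof. by rewrite -normcN opprB. Qed.
Lemma ler_dist_normc z w : `|N z - N w| <= N (z - w).
Proof.
have := le_normcD (z - w) w; have := le_normcD (w - z) z; rewrite !subrK normc_distC.
by rewrite ler_norml => *; apply/andP; split; lra.
Qed.
Lemma normcX z n : N (z ^+ n) = N z ^+ n.
Proof. by elim: n => [|n IH]; rewrite ?normc_1 // !exprS Normc.normcM IH. Qed.
Lemma normc_eq0 z : (N z == 0) = (z == 0).
Proof.
apply/eqP/eqP => [|->]; last exact: normc_0.
exact: Normc.eq0_normc.
Qed.
Lemma normc_real (x : R) : N x%:C = `|x|.
Proof. by rewrite /= expr0n addr0 sqrtr_sqr. Qed.
Lemma normc_nat n : N n%:R = n%:R.
Proof.
rewrite (_ : n%:R = (n%:R : R)%:C) ?normc_real ?normr_nat //.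
by rewrite rmorph_nat.
Qed.
Lemma sqr_normcE z : N z ^+ 2 = re z ^+ 2 + im z ^+ 2.
Proof. by case: z => a b /=; rewrite sqr_sqrtr // addr_ge0 ?sqr_ge0. Qed.
Lemma normc_conj z : N z^* = N z.
Proof. by case: z => a b /=; rewrite sqrrN. Qed.
Lemma normr_Re_le z : `|re z| <= N z.
Proof.
by rewrite -[leLHS]sqrtr_sqr; case: z => a b /=; rewrite ler_wsqrtr // lerDl sqr_ge0.
Qed.
Lemma normr_Im_le z : `|im z| <= N z.
Proof.
by rewrite -[leLHS]sqrtr_sqr; case: z => a b /=; rewrite ler_wsqrtr // lerDr sqr_ge0.
Qed.
Lemma normc_le_ReIm z : N z <= `|re z| + `|im z|.
Proof.
case: z => a b; rewrite [X in N X](_ : _ = a%:C + b%:C * 'i); last by simpc.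
rewrite (le_trans (le_normcD _ _)) // Normc.normcM !normc_real (_ : N 'i = 1) ?mulr1 //.
by rewrite /= expr0n expr1n add0r sqrtr1.
Qed.
Lemma normc_sum_le (I : Type) (r : seq I) (P : pred I) (F : I -> C) :
  N (\sum_(i <- r | P i) F i) <= \sum_(i <- r | P i) N (F i).
Proof.
elim/big_rec2: _ => [|i y x _ h]; first by rewrite normc_0.
by rewrite (le_trans (le_normcD _ _)) // lerD2l.
Qed.

Lemma Re_add z w : re (z + w) = re z + re w. Proof. by case: z w => ? ? []. Qed.
Lemma Im_add z w : im (z + w) = im z + im w. Proof. by case: z w => ? ? []. Qed.
Lemma Re_opp z : re (- z) = - re z. Proof. by case: z. Qed.
Lemma Im_opp z : im (- z) = - im z. Proof. by case: z. Qed.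
Lemma Re_mul z w : re (z * w) = re z * re w - im z * im w.
Proof. by case: z w => ? ? []. Qed.
Lemma Im_mul z w : im (z * w) = re z * im w + im z * re w.
Proof. by case: z w => ? ? []. Qed.

(** Convergence is split into real and imaginary parts so that the limit laws reduce to those of
    real sequences; [power_sumE] translates to the convergence used in [power_sum]. *)
Definition cvgC (s : nat -> C) l :=
  (re (s n) @[n --> \oo] --> re l) /\ (im (s n) @[n --> \oo] --> im l).

Lemma cvgC_normP s l : cvgC s l <-> (N (s n - l) @[n --> \oo] --> (0 : R)).
Proof.
split=> [[h1 h2]|h].
- apply: (@squeeze_cvgr _ _ _ _ (fun=> 0) (fun n => `|re (s n) - re l| + `|im (s n) - im l|)).
  + by apply: nearW => n; rewrite normc_ge0 (le_trans (normc_le_ReIm _)) // Re_add Im_add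
    Re_opp Im_opp.
  + exact: cvg_cst.
  + rewrite -[X in _ --> X](addr0 0); apply: cvgD.
      by rewrite -[X in _ --> X](@normr0 _ R) -(subrr (re l)); apply: cvg_norm;
        apply: cvgB => //; exact: cvg_cst.
    by rewrite -[X in _ --> X](@normr0 _ R) -(subrr (im l)); apply: cvg_norm;
      apply: cvgB => //; exact: cvg_cst.
- split; apply/cvgrPdist_lt => e e0; near=> n.
  + apply: (le_lt_trans _ (_ : N (s n - l) < e)).
      by rewrite distrC -Re_opp -Re_add normr_Re_le.
    near: n; move/cvgrPdist_lt: h => /(_ _ e0); apply: filterS => n.
    by rewrite norm_sub0_normc.
  + apply: (le_lt_trans _ (_ : N (s n - l) < e)).
      by rewrite distrC -Im_opp -Im_add normr_Im_le.
    near: n; move/cvgrPdist_lt: h => /(_ _ e0); apply: filterS => n.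
    by rewrite norm_sub0_normc.
Unshelve. all: by end_near. Qed.

Lemma cvgC_cst l : cvgC (fun=> l) l.
Proof. by split; exact: cvg_cst. Qed.
Lemma cvgC_D s t l k : cvgC s l -> cvgC t k -> cvgC (fun n => s n + t n) (l + k).
Proof.
case=> a b [c d]; split.
- by under eq_fun do rewrite Re_add; rewrite Re_add; exact: cvgD.
- by under eq_fun do rewrite Im_add; rewrite Im_add; exact: cvgD.
Qed.
Lemma cvgC_N s l : cvgC s l -> cvgC (fun n => - s n) (- l).
Proof.
case=> a b; split.
- by under eq_fun do rewrite Re_opp; rewrite Re_opp; exact: cvgN.
- by under eq_fun do rewrite Im_opp; rewrite Im_opp; exact: cvgN.
Qed.
Lemma cvgC_B s t l k : cvgC s l -> cvgC t k -> cvgC (fun n => s n - t n) (l - k).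
Proof. by move=> a b; apply: cvgC_D => //; exact: cvgC_N. Qed.
Lemma cvgC_M s t l k : cvgC s l -> cvgC t k -> cvgC (fun n => s n * t n) (l * k).
Proof.
case=> a b [c d]; split.
- by under eq_fun do rewrite Re_mul; rewrite Re_mul; apply: cvgB; exact: cvgM.
- by under eq_fun do rewrite Im_mul; rewrite Im_mul; apply: cvgD; exact: cvgM.
Qed.
Lemma cvgC_uniq s l k : cvgC s l -> cvgC s k -> l = k.
Proof.
case=> a b [c d]; case: l k a b c d => [x y] [x' y'] /= a b c d.
by congr Complex; [apply: (cvg_unique _ a c)|apply: (cvg_unique _ b d)].
Qed.
Lemma cvgC_shift s l k : cvgC (fun n => s (n + k)%N) l <-> cvgC s l.
Proof.
rewrite /cvgC (@cvg_shiftn k _ (fun n => re (s n))) (@cvg_shiftn k _ (fun n => im (s n))).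
by [].
Qed.
Lemma cvgC_norm s l : cvgC s l -> N (s n) @[n --> \oo] --> N l.
Proof.
move=> /cvgC_normP h; apply/cvgrPdist_lt => e e0; near=> n.
apply: (le_lt_trans _ (_ : N (s n - l) < e)).
  by rewrite distrC ler_dist_normc.
near: n; move/cvgrPdist_lt: h => /(_ _ e0); apply: filterS => n.
by rewrite norm_sub0_normc.
Unshelve. all: by end_near. Qed.
Lemma cvgC_le s l B : cvgC s l -> (forall n, N (s n) <= B) -> N l <= B.
Proof.
move=> /cvgC_norm h hB; rewrite -(cvg_lim _ h) //; apply: limr_le.
  by apply/cvg_ex; eexists; exact: h.
exact: nearW.
Qed.
Lemma cvgC_squeeze s l (b : nat -> R) : (forall n, N (s n - l) <= b n) ->
  b @ \oo --> (0 : R) -> cvgC s l.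
Proof.
move=> h hb; apply/cvgC_normP.
apply: (@squeeze_cvgr _ _ _ _ (fun=> 0) b) => //; last exact: cvg_cst.
by apply: nearW => n; rewrite normc_ge0 h.
Qed.

Lemma power_sumE (c : nat -> C) z l :
  power_sum c z l <-> cvgC (fun n => \sum_(k < n) c k * z ^+ k) l.
Proof.
rewrite cvgC_normP /power_sum.
have E n : series (fun k => c k * z ^+ k) n = \sum_(k < n) c k * z ^+ k.
  by rewrite /series /= big_mkord.
split=> [/cvgrPdist_lt h|/cvgrPdist_lt h]; apply/cvgrPdist_lt => e e0.
- have : 0 < e%:C :> C by rewrite ltcR.
  move/h; apply: filterS => n; rewrite E.
  by rewrite norm_sub0_normc normc_distC -ltcR.
(* In the order of [R[i]], a positive [e] has zero imaginary part, so it is the image of a positive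
   real. *)
- have e1 : (0 : R) < re e by move: e0; rewrite ltcE => /andP[].
  have e2 : e = (re e)%:C.
    by case: e e0 e1 => x y; rewrite ltcE /= => /andP[/eqP -> _].
  move: (h _ e1); apply: filterS => n; rewrite E.
  by rewrite norm_sub0_normc normc_distC e2 -ltcR.
Qed.

End ComplexNorm.

(** * Power series *)

Section PowerSeries.
Variable R : realType.
Local Notation C := R[i].
Local Notation N := (@Normc.normc R).
Local Notation re := (@complex.Re R).
Local Notation im := (@complex.Im R).
Implicit Types (z w l : C) (c : nat -> C) (r t K : R).

Lemma sum_geo_le t n : 0 <= t < 1 -> \sum_(k < n) t ^+ k <= (1 - t)^-1.
Proof.
case/andP=> t0 t1; have t2 : 0 < 1 - t by rewrite subr_gt0.
rewrite -(ler_pM2r t2) mulVf ?gt_eqF // mulrC.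
have -> : (1 - t) * (\sum_(k < n) t ^+ k) = 1 - t ^+ n.
  by rewrite -[RHS]opprB subrX1 -mulNr opprB.
by rewrite lerBlDr lerDl exprn_ge0.
Qed.

(** Since [t < 1], each of the [n] copies of [t ^+ n] is at most one of the terms [t ^+ k] with
    [k < n] of the geometric sum. *)
Lemma natX_le t n : 0 <= t < 1 -> n%:R * t ^+ n <= (1 - t)^-1.
Proof.
move=> /andP[t0 t1]; apply: le_trans (sum_geo_le n _); last by rewrite t0.
rewrite -{1}[n]card_ord -sumr_const mulr_suml; apply: ler_sum => k _.
by rewrite mul1r; apply: ler_wiXn2l; rewrite ?(ltW t1) ?t0 ?(ltnW (ltn_ord k)).
Qed.

Lemma cvgC_series_dom (u : nat -> C) K t : 0 <= t < 1 ->
  (forall n, N (u n) <= K * t ^+ n) ->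
  exists l, cvgC (fun n => \sum_(k < n) u k) l.
Proof.
move=> /andP[t0 t1] hu.
have K0 : 0 <= K by have := hu 0; rewrite mulr1; apply: le_trans; exact: normc_ge0.
have aux (v : nat -> R) : (forall n, `|v n| <= N (u n)) -> cvgn (series v).
  move=> hv; apply: normed_cvg.
  apply: (@series_le_cvg _ _ (geometric K t)) => //.
  - by move=> n /=.
  - by move=> n /=; rewrite mulr_ge0 // exprn_ge0.
  - by move=> n; apply: le_trans (hv n) (hu n).
  - by apply: is_cvg_geometric_series; rewrite ger0_norm.
have h1 := aux (fun n => re (u n)) (fun n => normr_Re_le (u n)).
have h2 := aux (fun n => im (u n)) (fun n => normr_Im_le (u n)).
have reS n : re (\sum_(k < n) u k) = series (fun n => re (u n)) n.
  rewrite /series /= big_mkord.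
  by elim: n => [|n IH]; rewrite ?big_ord0 // !big_ord_recr /= Re_add IH.
have imS n : im (\sum_(k < n) u k) = series (fun n => im (u n)) n.
  rewrite /series /= big_mkord.
  by elim: n => [|n IH]; rewrite ?big_ord0 // !big_ord_recr /= Im_add IH.
exists (limn (series (fun n => re (u n))) +i* limn (series (fun n => im (u n)))).
by split=> /=; [under eq_fun do rewrite reS|under eq_fun do rewrite imS].
Qed.

(** Radius of convergence at least [r], in Abel's form: bounded terms at each smaller radius.
    Boundedness survives shifts, sums and multiplication by [n], and it yields geometric domination
    at any smaller radius. *)
Definition radius_ge c r := forall x : R, 0 <= x < r ->
  exists K : R, forall n, N (c n) * x ^+ n <= K.

Definition psum c z : C := xget 0 [set l | power_sum c z l].

Lemma power_sum_uniq c z l l' : power_sum c z l -> power_sum c z l' -> l = l'.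
Proof. by move=> /power_sumE h /power_sumE; exact: cvgC_uniq. Qed.

Lemma psum_eq c z l : power_sum c z l -> psum c z = l.
Proof.
move=> h; rewrite /psum; case: xgetP => [l' _ /= h'|/(_ l)//].
exact: power_sum_uniq h' h.
Qed.

Lemma eq_psum c c' z : c =1 c' -> psum c z = psum c' z.
Proof. by move=> /funext ->. Qed.

(** Abel's lemma: for [x] halfway between [N z] and [r] the terms are dominated by
    [K * (N z / x) ^+ n]. *)
Lemma psumP c r z : radius_ge c r -> N z < r -> power_sum c z (psum c z).
Proof.
move=> hc hz; pose x := (N z + r) / 2.
have z0 := normc_ge0 z.
have [xz xr] : N z < x /\ x < r by rewrite /x; split; lra.
have x0 : 0 < x by exact: le_lt_trans xz.
have [|K hK] := hc x; first by rewrite (ltW x0).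
have [l hl] : exists l, cvgC (fun n => \sum_(k < n) c k * z ^+ k) l.
  apply: (@cvgC_series_dom (fun k => c k * z ^+ k) K (N z / x)).
    by rewrite divr_ge0 ?(ltW x0) //= ltr_pdivrMr // mul1r.
  move=> n; rewrite Normc.normcM normcX expr_div_n mulrA ler_pdivlMr ?exprn_gt0 //.
  by rewrite mulrAC ler_wpM2r ?exprn_ge0.
by rewrite (@psum_eq _ _ l) //; apply/power_sumE.
Qed.

(** Convergence at the real point [x] suffices: the terms are differences of consecutive partial
    sums, so they tend to 0 and are bounded. *)
Lemma power_sum_radius c r : (forall z, N z < r -> exists l, power_sum c z l) ->
  radius_ge c r.
Proof.
move=> h x /andP[x0 xr].
have [|l /power_sumE hl] := h x%:C; first by rewrite normc_real ger0_norm.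
have h0 : cvgC (fun n => c n * x%:C ^+ n) 0.
  rewrite -(subrr l).
  have -> : (fun n => c n * x%:C ^+ n) = (fun n =>
     \sum_(k < (n + 1)%N) c k * x%:C ^+ k - \sum_(k < n) c k * x%:C ^+ k).
    by apply/funext => n; rewrite addn1 big_ord_recr /= addrAC subrr add0r.
  apply: cvgC_B => //.
  exact: (cvgC_shift (fun n => \sum_(k < n) c k * x%:C ^+ k) l 1).2.
have /cvgC_norm hN := h0.
have cN : cvgn (fun n => N (c n * x%:C ^+ n)).
  by apply/cvg_ex; eexists; exact: hN.
have [K [_ hK]] := cvg_seq_bounded cN.
exists (K + 1) => n; have := hK (K + 1) (ltr_pwDr ltr01 (lexx _)) n I.
by rewrite /= ger0_norm ?normc_ge0 // Normc.normcM normcX normc_real (ger0_norm x0).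
Qed.



Lemma midpoint_lt r x : 0 <= x < r -> exists2 y, x < y & 0 < y < r.
Proof.
move=> /andP[x0 xr]; exists ((x + r) / 2); first lra.
by apply/andP; split; lra.
Qed.

Lemma radius_ge_le c c' K r : (forall n, N (c' n) <= K * N (c n)) -> radius_ge c r -> radius_ge
  c' r.
Proof.
move=> h hc x xr; have [M hM] := hc x xr; exists (`|K| * M) => n.
have x0 : 0 <= x by case/andP: xr.
apply: (@le_trans _ _ (`|K| * (N (c n) * x ^+ n))); last by rewrite ler_wpM2l.
rewrite mulrA ler_wpM2r ?exprn_ge0 // (le_trans (h n)) // ler_wpM2r ?normc_ge0 //.
exact: ler_norm.
Qed.

(** The factor [n] is absorbed by [(x / y) ^+ n] for an intermediate radius [y]. *)
Lemma radius_ge_natM c r : radius_ge c r -> radius_ge (fun n => n%:R * c n) r.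
Proof.
move=> hc x /[dup] xr /andP[x0 _].
have [y xy yr] := midpoint_lt xr; have y0 : 0 < y by case/andP: yr.
have [|M hM] := hc y; first by case/andP: yr => /ltW -> ->.
have t01 : 0 <= x / y < 1.
  by rewrite divr_ge0 ?(ltW y0) //= ltr_pdivrMr // mul1r.
exists ((1 - x / y)^-1 * M) => n.
have -> : N (n%:R * c n) * x ^+ n = (n%:R * (x / y) ^+ n) * (N (c n) * y ^+ n).
  rewrite Normc.normcM normc_nat expr_div_n; field.
  by rewrite expf_neq0 // gt_eqF.
apply: ler_pM => //; last exact: natX_le.
- by case/andP: t01 => t0 _; rewrite mulr_ge0 // exprn_ge0.
- by rewrite mulr_ge0 ?normc_ge0 // exprn_ge0 // ltW.
Qed.

Lemma radius_ge_shift c r k : radius_ge c r -> radius_ge (fun n => c (n + k)%N) r.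
Proof.
move=> hc x /[dup] xr /andP[x0 _].
have [y xy yr] := midpoint_lt xr; have y0 : 0 < y by case/andP: yr.
have [|M hM] := hc y; first by case/andP: yr => /ltW -> ->.
exists (M / y ^+ k) => n.
rewrite ler_pdivlMr ?exprn_gt0 // (le_trans _ (hM (n + k)%N)) // exprD mulrA.
rewrite ler_wpM2r ?exprn_ge0 ?(ltW y0) // ler_wpM2l ?normc_ge0 //.
by rewrite lerXn2r ?nnegrE // ltW.
Qed.

Lemma radius_ge_unshift c r : radius_ge (fun n => c n.+1) r -> radius_ge c r.
Proof.
move=> hc x /[dup] xr /andP[x0 _]; have [M hM] := hc x xr.
exists (N (c 0) + M * x) => -[|n].
  rewrite mulr1 lerDl mulr_ge0 //; apply: le_trans (hM 0).
  by rewrite mulr1 normc_ge0.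
by rewrite exprSr mulrA (le_trans (ler_wpM2r x0 (hM n))) // lerDr normc_ge0.
Qed.

Lemma radius_ge_D c c' r : radius_ge c r -> radius_ge c' r -> radius_ge (fun n => c n + c' n) r.
Proof.
move=> h h' x /[dup] xr /andP[x0 _].
have [M hM] := h x xr; have [M' hM'] := h' x xr; exists (M + M') => n.
rewrite (le_trans _ (lerD (hM n) (hM' n))) // -mulrDl ler_wpM2r ?exprn_ge0 //.
exact: le_normcD.
Qed.

Lemma radius_ge_sum_le c r x : radius_ge c r -> 0 <= x < r ->
  exists M, forall n, \sum_(k < n) N (c k) * x ^+ k <= M.
Proof.
move=> hc /[dup] xr /andP[x0 _].
have [y xy yr] := midpoint_lt xr; have y0 : 0 < y by case/andP: yr.
have [|M hM] := hc y; first by case/andP: yr => /ltW -> ->.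
have t01 : 0 <= x / y < 1.
  by rewrite divr_ge0 ?(ltW y0) //= ltr_pdivrMr // mul1r.
have M0 : 0 <= M by apply: le_trans (hM 0); rewrite mulr1 normc_ge0.
exists (M * (1 - x / y)^-1) => n.
apply: (@le_trans _ _ (M * \sum_(k < n) (x / y) ^+ k)); last first.
  by rewrite ler_wpM2l // sum_geo_le.
rewrite mulr_sumr; apply: ler_sum => k _.
rewrite expr_div_n mulrA ler_pdivlMr ?exprn_gt0 // mulrAC.
by rewrite ler_wpM2r ?exprn_ge0.
Qed.

Definition dcoef c n : C := n.+1%:R * c n.+1.

Lemma radius_ge_dcoef c r : radius_ge c r -> radius_ge (dcoef c) r.
Proof.
move/radius_ge_natM/(radius_ge_shift 1); under [X in radius_ge X]eq_fun do rewrite addn1.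
by [].
Qed.

(* A second-order estimate: stronger than differentiability, and enough for the
   functions at hand. *)
Definition qdiff (F : C -> C) z l := exists K (e : R), 0 < e /\
  forall w, N (w - z) < e -> N (F w - F z - (w - z) * l) <= K * N (w - z) ^+ 2.

(** Induction on [n]: the remainder at [n.+1] is [w] times the remainder at [n] plus
    [n z^(n-1) (w - z)^2], and n^2 + n <= (n+1)^2. Writing [x ^+ n / x ^+ 2] avoids a truncated
    exponent; in [z ^+ n.-1] the truncation at [n = 0] is masked by the factor [n%:R]. *)
Lemma expr_taylor_le z w x n : N z <= x -> N w <= x -> 0 < x ->
  N (w ^+ n - z ^+ n - (w - z) * (n%:R * z ^+ n.-1)) <=
  n%:R ^+ 2 * x ^+ n / x ^+ 2 * N (w - z) ^+ 2.
Proof.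
move=> zx wx x0; elim: n => [|n IH].
  by rewrite !expr0 subrr mul0r mulr0 subrr normc_0 expr0n !mul0r.
have -> : w ^+ n.+1 - z ^+ n.+1 - (w - z) * (n.+1%:R * z ^+ n.+1.-1) =
    w * (w ^+ n - z ^+ n - (w - z) * (n%:R * z ^+ n.-1))
    + n%:R * z ^+ n.-1 * (w - z) ^+ 2.
  case: n {IH} => [|n]; rewrite /= ?exprS -?natr1; ring.
apply: le_trans (le_normcD _ _) _; rewrite !Normc.normcM normc_nat !normcX.
have h1 : N w * N (w ^+ n - z ^+ n - (w - z) * (n%:R * z ^+ n.-1)) <=
   x * (n%:R ^+ 2 * x ^+ n / x ^+ 2 * N (w - z) ^+ 2).
  by apply: ler_pM => //; exact: normc_ge0.
have h2 : n%:R * N z ^+ n.-1 * N (w - z) ^+ 2 <=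
   x * (n%:R * x ^+ n / x ^+ 2 * N (w - z) ^+ 2).
  case: n {IH h1} => [|n]; first by rewrite !mul0r mulr0.
  rewrite [leRHS](_ : _ = n.+1%:R * x ^+ n * N (w - z) ^+ 2); last first.
    by rewrite exprS; field; rewrite gt_eqF.
  rewrite ler_wpM2r ?sqr_ge0 // ler_wpM2l //=.
  by rewrite lerXn2r ?nnegrE ?normc_ge0 // ltW.
apply: le_trans (lerD h1 h2) _.
have P0 : 0 <= x ^+ n.+1 / x ^+ 2 * N (w - z) ^+ 2.
  by rewrite mulr_ge0 ?sqr_ge0 // mulr_ge0 ?invr_ge0 ?sqr_ge0 // exprn_ge0 // ltW.
move: P0; rewrite exprS; move: (x ^+ n) (x ^+ 2)^-1 (N (w - z)) => X Y D P0.
rewrite [leLHS](_ : _ = (n%:R ^+ 2 + n%:R) * (x * X * Y * D ^+ 2)); last by ring.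
rewrite [leRHS](_ : _ = n.+1%:R ^+ 2 * (x * X * Y * D ^+ 2)); last by ring.
rewrite ler_wpM2r // -natr1; have : 0 <= n%:R :> R by [].
by nra.
Qed.

(** The estimate of [expr_taylor_le] is summed term by term; its factor n^2 is paid for by applying
    [radius_ge_natM] twice. *)
Lemma qdiff_psum c r z : radius_ge c r -> N z < r ->
  qdiff (psum c) z (psum (dcoef c) z).
Proof.
move=> hc hz; have [x zx /[dup] xr /andP[x0 _]] : exists2 y, N z < y & 0 < y < r.
  by apply: midpoint_lt; rewrite normc_ge0.
have xr' : 0 <= x < r by case/andP: xr => /ltW -> ->.
have [M hM] := radius_ge_sum_le (radius_ge_natM (radius_ge_natM hc)) xr'.
exists (M / x ^+ 2), (x - N z); split; first by rewrite subr_gt0.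
move=> w hw; have wx : N w < x.
  by rewrite -(subrK z w) (le_lt_trans (le_normcD _ _)) // -ltrBrDr.
have wr : N w < r by case/andP: xr => _; exact: lt_trans.
have /power_sumE hSw := psumP hc wr.
have /power_sumE hSz := psumP hc hz.
have /power_sumE hDz := psumP (radius_ge_dcoef hc) hz.
(* The constant term has no derivative, so [n] terms of the derived series match [n + 1] terms of
   the original one. *)
move/(cvgC_shift _ _ 1).2: hSw => hSw; move/(cvgC_shift _ _ 1).2: hSz => hSz.
have := cvgC_B (cvgC_B hSw hSz) (cvgC_M (cvgC_cst (w - z)) hDz).
move/cvgC_le; apply=> n.
have -> : \sum_(k < (n + 1)%N) c k * w ^+ k - \sum_(k < (n + 1)%N) c k * z ^+ k
   - (w - z) * (\sum_(k < n) dcoef c k * z ^+ k) =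
  \sum_(k < (n + 1)%N) c k * (w ^+ k - z ^+ k - (w - z) * (k%:R * z ^+ k.-1)).
  rewrite addn1 [X in _ = X](eq_bigr (fun k : 'I_n.+1 => c k * w ^+ k - c k * z ^+ k
     - (w - z) * (k%:R * c k * z ^+ k.-1))); last by move=> k _; ring.
  rewrite [RHS]sumrB sumrB; congr (_ - _); rewrite -mulr_sumr; congr (_ * _).
  by rewrite big_ord_recl !mul0r add0r; apply: eq_bigr => k _; rewrite /dcoef lift0.
apply: le_trans (normc_sum_le _ _ _) _.
apply: (@le_trans _ _ ((\sum_(k < (n + 1)%N) N (k%:R * (k%:R * c k)) * x ^+ k) / x ^+ 2
    * N (w - z) ^+ 2)); last first.
  by do 2 rewrite ler_wpM2r ?invr_ge0 ?sqr_ge0 //.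
rewrite !mulr_suml; apply: ler_sum => k _; rewrite !Normc.normcM !normc_nat.
rewrite (le_trans (ler_wpM2l (normc_ge0 _) (expr_taylor_le k (ltW zx) (ltW wx) x0))) //.
by rewrite le_eqVlt; apply/orP; left; apply/eqP; ring.
Qed.

Lemma qdiff_eq (F G : C -> C) z l (e : R) : 0 < e ->
  (forall w, N (w - z) < e -> F w = G w) -> qdiff F z l -> qdiff G z l.
Proof.
move=> e0 h [K [e' [e'0 h']]]; exists K, (Num.min e e'); split.
  by rewrite lt_min e0.
move=> w; rewrite lt_min => /andP[w1 w2]; rewrite -h // -h ?h' //.
by rewrite subrr normc_0.
Qed.

Lemma qdiff_shift (F : C -> C) z a l : qdiff F (z - a) l ->
  qdiff (fun w => F (w - a)) z l.
Proof.
move=> [K [e [e0 h]]]; exists K, e; split=> // w hw.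
have E : w - a - (z - a) = w - z by rewrite opprB addrA subrK.
by have := h (w - a); rewrite E; exact.
Qed.

Lemma qdiff_cont (F : C -> C) z l : qdiff F z l ->
  forall e : R, 0 < e -> exists2 d : R, 0 < d &
  forall w, N (w - z) < d -> N (F w - F z) < e.
Proof.
move=> [K [d [d0 h]]] e e0.
have A0 : 0 < `|K| * d + N l + 1 by rewrite ltr_wpDl // addr_ge0 ?normc_ge0 // mulr_ge0 // ltW.
exists (Num.min d (e / (`|K| * d + N l + 1))); first by rewrite lt_min d0 divr_gt0.
move=> w; rewrite lt_min => /andP[wd we].
rewrite -(subrK ((w - z) * l) (F w - F z)).
apply: le_lt_trans (le_normcD _ _) _; rewrite Normc.normcM.
apply: (le_lt_trans (_ : _ <= (`|K| * d + N l + 1) * N (w - z))); last first.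
  by rewrite mulrC -ltr_pdivlMr.
have h1 : N (F w - F z - (w - z) * l) <= `|K| * d * N (w - z).
  apply: le_trans (h w wd) _; rewrite expr2 mulrA ler_wpM2r ?normc_ge0 //.
  rewrite (le_trans (_ : _ <= `|K| * N (w - z))) //.
    by rewrite ler_wpM2r ?normc_ge0 // ler_norm.
  by rewrite ler_wpM2l // ltW.
have := normc_ge0 (w - z); move: h1; move: (N (F w - _ - _)) => X h1 D0; lra.
Qed.

End PowerSeries.

(** * Uniqueness of coefficients, Cauchy products and recentring of power series *)

Section PowerSeriesIdentities.
Variable R : realType.
Local Notation C := R[i].
Local Notation N := (@Normc.normc R).
Implicit Types (z w l : C) (c : nat -> C) (r t K : R).

Lemma radius_ge_psum_le c r x : radius_ge c r -> 0 <= x < r ->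
  exists M, forall z, N z <= x -> N (psum c z) <= M.
Proof.
move=> hc /[dup] xr /andP[x0 xr']; have [M hM] := radius_ge_sum_le hc xr.
exists M => z hz; have /power_sumE := psumP hc (le_lt_trans hz xr').
move/cvgC_le; apply=> n; apply: le_trans (normc_sum_le _ _ _) (le_trans _ (hM n)).
apply: ler_sum => k _; rewrite Normc.normcM normcX ler_wpM2l ?normc_ge0 //.
by rewrite lerXn2r ?nnegrE ?normc_ge0.
Qed.

Lemma power_sum_split c z l k : power_sum (fun n => c (n + k)%N) z l ->
  power_sum c z (\sum_(i < k) c i * z ^+ i + z ^+ k * l).
Proof.
move=> /power_sumE h; apply/power_sumE/(cvgC_shift _ _ k).1.
have -> : (fun n => \sum_(i < (n + k)%N) c i * z ^+ i) = (fun n =>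
   \sum_(i < k) c i * z ^+ i + z ^+ k * \sum_(i < n) c (i + k)%N * z ^+ i).
  apply/funext => n; rewrite addnC big_split_ord /=; congr (_ + _).
  by rewrite mulr_sumr; apply: eq_bigr => i _; rewrite exprD [(k + i)%N]addnC mulrCA.
by apply: cvgC_D; [exact: cvgC_cst|apply: cvgC_M => //; exact: cvgC_cst].
Qed.

Lemma power_sum0 c : power_sum c 0 (c 0).
Proof.
apply/power_sumE/(cvgC_shift _ _ 1).1.
rewrite (_ : (fun n => _) = (fun=> c 0)); first exact: cvgC_cst.
apply/funext => n; rewrite addn1 big_ord_recl mulr1 big1 ?addr0 // => i _.
by rewrite lift0 exprS mul0r mulr0.
Qed.

Lemma psum_split c r z k : radius_ge c r -> N z < r ->
  psum c z = \sum_(i < k) c i * z ^+ i + z ^+ k * psum (fun n => c (n + k)%N) z.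
Proof.
by move=> hc hz; apply/psum_eq/power_sum_split/psumP; [exact: radius_ge_shift hc|].
Qed.

(** Only the punctured disk is assumed, because the induction in [power_sum_zero] divides by [z].
    The sum is [c 0 + z * s z] with [s] bounded by some [M] on |z| <= r/2, so [N (c 0) <= N z * M]
    for arbitrarily small nonzero [z]. *)
Lemma power_sum_zero_head c r : 0 < r ->
  (forall z, 0 < N z < r -> power_sum c z 0) -> radius_ge c r /\ c 0 = 0.
Proof.
move=> r0 h.
have hc : radius_ge c r.
  apply: power_sum_radius => z hz; have [->|z0] := eqVneq z 0.
    by exists (c 0); exact: power_sum0.
  by exists 0; apply: h; rewrite hz lt_def normc_ge0 normc_eq0 z0.
split=> //.
have [|M hM] := radius_ge_psum_le (x := r / 2) (radius_ge_shift 1 hc); first lra.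
apply/eqP; rewrite -normc_eq0 eq_le normc_ge0 andbT; apply/ler_addgt0Pr => e e0; rewrite add0r.
have M0 : 0 <= M by apply: le_trans (hM 0 _); rewrite ?normc_ge0 // normc_0; lra.
have A0 : 0 < M + 1 by lra.
pose x := Num.min (r / 2) (e / (M + 1)).
have x0 : 0 < x by rewrite lt_min !divr_gt0.
have xr : x <= r / 2 by rewrite ge_min lexx.
have xe : x * M <= e.
  apply: (@le_trans _ _ (x * (M + 1))); first by rewrite ler_wpM2l ?(ltW x0) // lerDl.
  by rewrite -ler_pdivlMr // ge_min lexx orbT.
have xz : N x%:C = x by rewrite normc_real gtr0_norm.
have xlr : x < r by lra.
have xlr' : N x%:C < r by rewrite xz.
have := psum_split 1 hc xlr'; rewrite big_ord_recl big_ord0 !addr0 mulr1.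
have -> : psum c x%:C = 0 by apply: psum_eq; apply: h; rewrite xz x0 xlr.
move/eqP; rewrite eq_sym addr_eq0 => /eqP ->.
by rewrite normcN Normc.normcM expr1 xz (le_trans _ xe) // ler_wpM2l ?(ltW x0) // hM // xz.
Qed.

Lemma power_sum_zero c r : 0 < r -> (forall z, 0 < N z < r -> power_sum c z 0) ->
  forall n, c n = 0.
Proof.
move=> r0 h n; elim: n c h => [|n IH] c h; have [hc c0] := power_sum_zero_head r0 h; first by [].
rewrite -addn1; apply: (IH (fun n => c (n + 1)%N)) => z hz.
have [z0 zr] := andP hz.
have z_neq0 : z != 0 by rewrite -normc_eq0 gt_eqF.
have E := psum_split 1 hc zr; rewrite big_ord1 c0 mul0r add0r expr1 in E.
have S0 : psum (fun n => c (n + 1)%N) z = 0.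
  by apply: (mulfI z_neq0); rewrite -E mulr0; exact: psum_eq (h _ hz).
by rewrite -[X in power_sum _ _ X]S0; exact: psumP (radius_ge_shift 1 hc) zr.
Qed.

(** With [s] the fourth root of [t], two of the four factors [s ^+ n] absorb n^2 by [natX_le], and
    the other two leave a convergent geometric sequence. *)
Lemma natX2_cvg0 t : 0 <= t < 1 -> (fun n => n%:R ^+ 2 * t ^+ n) @ \oo --> (0 : R).
Proof.
move=> /andP[t0 t1]; pose s := Num.sqrt (Num.sqrt t).
have s0 : 0 <= s by exact: sqrtr_ge0.
have s4 : t = (s * s) * (s * s).
  by rewrite -!expr2 !sqr_sqrtr ?sqrtr_ge0.
have s1 : s < 1.
  rewrite -(expr_lt1 (n := 4)) // (_ : s ^+ 4 = t) // s4; ring.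
have ss1 : s * s < 1 by nra.
apply: (@squeeze_cvgr _ _ _ _ (fun=> 0) (geometric ((1 - s)^-1 ^+ 2) (s * s))).
- apply: nearW => n; apply/andP; split; first by rewrite mulr_ge0 ?sqr_ge0 ?exprn_ge0.
  rewrite s4 /= !exprMn.
  rewrite (_ : _ * _ = (n%:R * s ^+ n) ^+ 2 * (s ^+ n * s ^+ n)); last by ring.
  rewrite ler_wpM2r ?mulr_ge0 ?exprn_ge0 // lerXn2r ?nnegrE ?mulr_ge0 ?exprn_ge0 ?invr_ge0 //.
    by rewrite subr_ge0 ltW.
  by apply: natX_le; rewrite s0.
- exact: cvg_cst.
- by apply: cvg_geometric; rewrite ger0_norm // mulr_ge0.
Qed.

Definition cauchy_coef (a d : nat -> C) k : C := \sum_(i < k.+1) a (k - i)%N * d i.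

Lemma sum_triangle (F : nat -> nat -> C) n :
  \sum_(k < n) \sum_(i < k.+1) F (k - i)%N i = \sum_(i < n) \sum_(j < (n - i)%N) F j i.
Proof.
elim: n => [|n IH]; first by rewrite !big_ord0.
rewrite big_ord_recr /= IH [in RHS]big_ord_recr /= subSnn big_ord1.
rewrite [X in _ + X = _]big_ord_recr /= subnn addrA; congr (_ + _).
rewrite -big_split /=; apply: eq_bigr => i _.
by rewrite subSn ?(ltnW (ltn_ord i)) // big_ord_recr.
Qed.

Lemma sum_ord_split (V : zmodType) (G : nat -> V) n k : (k <= n)%N -> \sum_(j < n) G j =
  \sum_(j < (n - k)%N) G j + \sum_(j < k) G (n - k + j)%N.
Proof. by move=> h; rewrite -[in LHS](subnK h) big_split_ord. Qed.

(** The product of the [n]-th partial sums exceeds the [n]-th Cauchy partial sum by the terms with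
    i, j < n and i + j >= n. There are at most n^2 of them, each bounded by [K * L * t ^+ n], so
    [natX2_cvg0] finishes. *)
Lemma power_sum_mul a d r z : radius_ge a r -> radius_ge d r -> N z < r ->
  power_sum (cauchy_coef a d) z (psum a z * psum d z).
Proof.
move=> ha hd hz; have [x zx /andP[x0 xr]] : exists2 y, N z < y & 0 < y < r.
  by apply: midpoint_lt; rewrite normc_ge0.
have xr' : 0 <= x < r by rewrite (ltW x0).
have [K hK] := ha x xr'; have [L hL] := hd x xr'.
pose t := N z / x.
have t0 : 0 <= t by rewrite divr_ge0 ?normc_ge0 ?(ltW x0).
have t1 : t < 1 by rewrite ltr_pdivrMr // mul1r.
have K0 : 0 <= K by apply: le_trans (hK 0); rewrite mulr1 normc_ge0.
have L0 : 0 <= L by apply: le_trans (hL 0); rewrite mulr1 normc_ge0.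
have bnd c (M : R) : (forall n, N (c n) * x ^+ n <= M) ->
    forall n, N (c n * z ^+ n) <= M * t ^+ n.
  move=> h n; rewrite Normc.normcM normcX expr_div_n mulrA ler_pdivlMr ?exprn_gt0 //.
  by rewrite mulrAC ler_wpM2r ?exprn_ge0 ?normc_ge0.
have /power_sumE hA := psumP ha hz; have /power_sumE hD := psumP hd hz.
have hAD := cvgC_M hA hD.
apply/power_sumE.
pose e n := \sum_(k < n) cauchy_coef a d k * z ^+ k -
  (\sum_(k < n) a k * z ^+ k) * (\sum_(k < n) d k * z ^+ k).
have he : cvgC e 0.
  apply: (@cvgC_squeeze _ _ _ (fun n => K * L * (n%:R ^+ 2 * t ^+ n))); last first.
    rewrite -[X in _ --> X](mulr0 (K * L)); apply: cvgM; first exact: cvg_cst.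
    by apply: natX2_cvg0; rewrite t0.
  move=> n; rewrite subr0 /e -normcN opprB.
  pose F j i := (a j * z ^+ j) * (d i * z ^+ i).
  rewrite [X in _ - X](_ : _ = \sum_(k < n) \sum_(i < k.+1) F (k - i)%N i); last first.
    apply: eq_bigr => k _; rewrite /cauchy_coef mulr_suml; apply: eq_bigr => i _.
    have -> : z ^+ k = z ^+ (k - i) * z ^+ i by rewrite -exprD subnK // -ltnS.
    by rewrite /F; ring.
  rewrite sum_triangle mulrC mulr_suml -sumrB.
  apply: le_trans (normc_sum_le _ _ _) _.
  rewrite (_ : _ * (n%:R ^+ 2 * t ^+ n) = \sum_(i < n) n%:R * (K * L * t ^+ n)); last first.
    by rewrite sumr_const card_ord -mulr_natl; ring.
  apply: ler_sum => i _.
  rewrite mulr_sumr (sum_ord_split (fun j => d i * z ^+ i * (a j * z ^+ j)) (ltnW (ltn_ord i))).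
  rewrite (eq_bigr (fun j : 'I_(n - i) => F j i)) => [|j _]; last by rewrite /F mulrC.
  rewrite addrAC subrr add0r; apply: le_trans (normc_sum_le _ _ _) _.
  apply: (@le_trans _ _ (\sum_(j < i) K * L * t ^+ n)).
    apply: ler_sum => j _; rewrite Normc.normcM.
    apply: (@le_trans _ _ ((L * t ^+ i) * (K * t ^+ (n - i + j)))).
      by apply: ler_pM; rewrite ?normc_ge0 // bnd.
    rewrite (_ : _ * _ = K * L * t ^+ (i + (n - i + j))); last by rewrite !exprD; ring.
    rewrite ler_wpM2l ?mulr_ge0 //; apply: ler_wiXn2l; rewrite ?(ltW t1) //.
    by rewrite addnA subnKC ?(ltnW (ltn_ord i)) // leq_addr.
  rewrite sumr_const card_ord -[leLHS]mulr_natl ler_wpM2r ?mulr_ge0 ?exprn_ge0 //.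
  by rewrite ler_nat ltnW.
have := cvgC_D he hAD; rewrite add0r.
rewrite (_ : (fun n => _) = (fun n => \sum_(k < n) cauchy_coef a d k * z ^+ k)) //.
by apply/funext => n; rewrite /e subrK.
Qed.

Lemma binomial_term_le (x y : R) m j : 0 <= x -> 0 <= y ->
  'C(m, j)%:R * x ^+ (m - j) * y ^+ j <= (x + y) ^+ m.
Proof.
move=> x0 y0; have [mj|jm] := ltnP m j.
  by rewrite bin_small // !mul0r exprn_ge0 // addr_ge0.
rewrite exprDn (bigD1 (Ordinal (jm : (j < m.+1)%N))) //= -mulrA mulr_natl lerDl.
by apply: sumr_ge0 => i _; rewrite mulrn_wge0 // mulr_ge0 ?exprn_ge0.
Qed.

(** The new coefficients are sum_m C(m,j) c_m z0^(m-j). The exchange of the two summations is made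
    quantitative: cutting the binomial expansion at [J] is exact for m < J and costs at most (|z0| +
    |w|)^m for m >= J. The total error is at most [K / (1 - t) * t ^+ J], uniformly in the cut-off
    [M] of the outer sum. *)
Lemma power_sum_recenter c r z0 : radius_ge c r -> N z0 < r ->
  exists e : nat -> C, forall w, N w < r - N z0 -> power_sum e w (psum c (z0 + w)).
Proof.
move=> hc hz; pose q : R := (r - N z0) / 2.
have z00 := normc_ge0 z0.
have q0 : 0 < q by rewrite /q; lra.
(* For [m < j] the binomial coefficient is 0, so the truncated exponent is harmless. *)
pose u j m := 'C(m, j)%:R * c m * z0 ^+ (m - j).
have /boolp.choice[e he] : forall j, exists x, cvgC (fun M => \sum_(m < M) u j m) x.
  move=> j.
  have [|y xy /andP[y0 yr]] := @midpoint_lt _ r (N z0 + q).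
    by rewrite addr_ge0 ?(ltW q0) //= /q; lra.
  have [|K hK] := hc y; first by rewrite (ltW y0).
  have t0 : 0 < N z0 + q by rewrite ltr_wpDl.
  apply: (@cvgC_series_dom _ (u j) (K / q ^+ j) ((N z0 + q) / y)).
    by rewrite divr_ge0 ?(ltW y0) ?(ltW t0) //= ltr_pdivrMr // mul1r.
  move=> m; rewrite /u !Normc.normcM normc_nat normcX.
  rewrite [leRHS]mulrAC ler_pdivlMr ?exprn_gt0 //.
  apply: (@le_trans _ _ (N (c m) * (N z0 + q) ^+ m)).
    rewrite (_ : _ * _ * q ^+ j = N (c m) * ('C(m, j)%:R * N z0 ^+ (m - j) * q ^+ j));
      last by ring.
    by rewrite ler_wpM2l ?normc_ge0 // binomial_term_le // ltW.
  rewrite expr_div_n mulrA ler_pdivlMr ?exprn_gt0 // mulrAC.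
  by rewrite ler_wpM2r ?exprn_ge0 // ltW.
exists e => w hw.
have hzw : N z0 + N w < r by rewrite -ltrBrDl.
have w0 := normc_ge0 w.
have hs : N (z0 + w) < r by apply: le_lt_trans (le_normcD _ _) hzw.
have [|y xy /andP[y0 yr]] := @midpoint_lt _ r (N z0 + N w).
  by rewrite addr_ge0.
have [|K hK] := hc y; first by rewrite (ltW y0).
pose t := (N z0 + N w) / y.
have t0 : 0 <= t by rewrite divr_ge0 ?addr_ge0 // ltW.
have t1 : t < 1 by rewrite ltr_pdivrMr // mul1r.
have K0 : 0 <= K by apply: le_trans (hK 0); rewrite mulr1 normc_ge0.
have /power_sumE hS := psumP hc hs.
apply/power_sumE/(@cvgC_squeeze _ _ _ (geometric (K / (1 - t)) t)); last first.
  by apply: cvg_geometric; rewrite ger0_norm.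
move=> J; rewrite /=.
have hE : cvgC (fun M => \sum_(j < J) (\sum_(m < M) u j m) * w ^+ j) (\sum_(j < J) e j * w ^+ j).
  elim: J => [|J IH].
    rewrite big_ord0; under eq_fun do rewrite big_ord0; exact: cvgC_cst.
  rewrite big_ord_recr; under eq_fun do rewrite big_ord_recr.
  by apply: cvgC_D => //; apply: cvgC_M => //; exact: cvgC_cst.
(* [J] stays fixed while [M] tends to infinity, so a bound independent of [M] passes to the
   limit. *)
apply: (cvgC_le (cvgC_B hE hS)) => M.
rewrite -normcN opprB.
have -> : \sum_(k < M) c k * (z0 + w) ^+ k - \sum_(j < J) (\sum_(m < M) u j m) * w ^+ j =
   \sum_(m < M) c m * ((z0 + w) ^+ m - \sum_(j < J) 'C(m, j)%:R * z0 ^+ (m - j) * w ^+ j).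
  under [X in _ - X]eq_bigr do rewrite mulr_suml.
  rewrite exchange_big -sumrB; apply: eq_bigr => m _.
  rewrite mulrBr; congr (_ - _); rewrite mulr_sumr; apply: eq_bigr => j _.
  by rewrite /u; ring.
apply: le_trans (normc_sum_le _ _ _) _.
have hm m : N (c m * ((z0 + w) ^+ m - \sum_(j < J) 'C(m, j)%:R * z0 ^+ (m - j) * w ^+ j))
   <= if (J <= m)%N then K * t ^+ m else 0.
  pose G j := 'C(m, j)%:R * z0 ^+ (m - j) * w ^+ j.
  rewrite (_ : (z0 + w) ^+ m = \sum_(j < m.+1) G j); last first.
    by rewrite exprDn; apply: eq_bigr => j _; rewrite /G -mulrA mulr_natl.
  rewrite -[X in _ - X]/(\sum_(j < J) G j).
  case: ifPn => [Jm|]; last first.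
    rewrite -ltnNge => mJ; rewrite (sum_ord_split G (leq_subr m.+1 J)).
    rewrite subKn // opprD addrA subrr add0r big1 ?oppr0 ?mulr0 ?normc_0 // => j _.
    by rewrite /G bin_small ?mul0r // leq_addr.
  have Jm1 : (J <= m.+1)%N by exact: leqW.
  rewrite (sum_ord_split G (leq_subr J m.+1)) subKn // addrAC subrr add0r Normc.normcM.
  apply: (@le_trans _ _ (N (c m) * (N z0 + N w) ^+ m)); last first.
    rewrite expr_div_n mulrA ler_pdivlMr ?exprn_gt0 // mulrAC.
    by rewrite ler_wpM2r ?exprn_ge0 // addr_ge0.
  rewrite ler_wpM2l ?normc_ge0 // (le_trans (normc_sum_le _ _ _)) //.
  have -> : (N z0 + N w) ^+ m = \sum_(j < m.+1) N (G j).
    by rewrite exprDn; apply: eq_bigr => j _;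
      rewrite /G -mulrA Normc.normcM normc_nat mulr_natl Normc.normcM !normcX.
  rewrite (sum_ord_split (fun j => N (G j)) (leq_subr J m.+1)) subKn // lerDr.
  by apply: sumr_ge0 => j _; exact: normc_ge0.
pose f m := if (J <= m)%N then K * t ^+ m else 0.
have f0 m : 0 <= f m by rewrite /f; case: ifP => // _; rewrite mulr_ge0 ?exprn_ge0.
apply: (@le_trans _ _ (\sum_(m < M) f m)); first by apply: ler_sum => m _; exact: hm.
apply: (@le_trans _ _ (\sum_(m < (J + M)%N) f m)).
  by rewrite addnC big_split_ord /= lerDl sumr_ge0.
rewrite big_split_ord /= big1 ?add0r => [|j _]; last by rewrite /f leqNgt ltn_ord.
rewrite (eq_bigr (fun j : 'I_M => K * t ^+ J * t ^+ j)) => [|j _]; last first.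
  by rewrite /f leq_addr exprD mulrA.
rewrite -mulr_sumr (_ : K / (1 - t) * t ^+ J = K * t ^+ J * (1 - t)^-1); last by ring.
by rewrite ler_wpM2l ?mulr_ge0 ?exprn_ge0 // sum_geo_le // t0.
Qed.

End PowerSeriesIdentities.

(** * Analytic functions on the disk *)

Section Analytic.
Variable R : realType.
Local Notation C := R[i].
Local Notation N := (@Normc.normc R).
Local Notation re := (@complex.Re R).
Implicit Types (z w l : C) (c : nat -> C) (r t K : R).

Lemma qdiff_cderiv (F : C -> C) z l : qdiff F z l -> cderiv F z = l.
Proof.
move=> [K [e [e0 h]]]; rewrite /cderiv /derive1.
apply: (@cvg_lim R[i]^o); first exact: norm_hausdorff.
apply/cvgrPdist_lt => eps eps0.
have eps1 : (0 : R) < re eps by move: eps0; rewrite ltcE => /andP[].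
have eps2 : eps = (re eps)%:C.
  by case: eps eps0 eps1 => x y; rewrite ltcE /= => /andP[/eqP -> _].
pose d : R := Num.min e (re eps / (`|K| + 1)).
have K1 : 0 < `|K| + 1 by rewrite ltr_wpDl.
have d0 : 0 < d by rewrite lt_min e0 divr_gt0.
exists d%:C => /=; first by rewrite ltcR.
move=> t /= ; rewrite sub0r normrN norm_normcE ltcR lt_min => /andP[te td] t0.
have Nt : 0 < N t by rewrite lt_def normc_eq0 t0 normc_ge0.
rewrite eps2 -normrN opprB norm_normcE ltcR.
have := h (t + z); rewrite addrK => /(_ te) {}h.
have -> : t^-1 *: (F (t + z) - F z : C^o) - l = t^-1 * (F (t + z) - F z - t * l).
  by rewrite [in RHS]mulrBr mulKf.
rewrite Normc.normcM Normc.normcV mulrC ltr_pdivrMr // (le_lt_trans h) // expr2 mulrA.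
rewrite ltr_pM2r //; apply: (@le_lt_trans _ _ ((`|K| + 1) * N t)).
  by rewrite ler_wpM2r ?normc_ge0 // (le_trans (ler_norm _)) // lerDl.
by rewrite mulrC -ltr_pdivlMr.
Qed.

Lemma analytic_atP (F : C -> C) z0 : analytic_at F z0 <-> exists c r, [/\ 0 < r,
  radius_ge c r & forall z, N (z - z0) < r -> F z = psum c (z - z0)].
Proof.
split=> [[c [r [r0 h]]]|[c [r [r0 hc h]]]]; exists c, r; split=> //.
- apply: power_sum_radius => z hz; exists (F (z + z0)).
  by have := h (z + z0); rewrite addrK norm_normcE ltcR => /(_ hz).
- by move=> z hz; rewrite (@psum_eq _ _ _ (F z)) //; apply: h; rewrite norm_normcE ltcR.
- move=> z; rewrite norm_normcE ltcR => hz; rewrite h //; exact: psumP hc hz.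
Qed.

Lemma disk_ball z : disk z -> exists2 r : R, 0 < r & forall w, N (w - z) < r -> disk w.
Proof.
rewrite diskP => hz; exists (1 - N z); first by rewrite subr_gt0.
move=> w hw; rewrite diskP -(subrK z w) (le_lt_trans (le_normcD _ _)) //.
by rewrite -ltrBrDr.
Qed.

(** The second conclusion supplies the continuity of the derivative, hence of the partial
    derivatives in [analytic_rC1]. *)
Lemma analytic_qdiff (F : C -> C) z : analytic_at F z ->
  qdiff F z (cderiv F z) /\ exists l, qdiff (cderiv F) z l.
Proof.
move=> /analytic_atP[c [r [r0 hc h]]].
have hq w : N (w - z) < r -> qdiff F w (psum (dcoef c) (w - z)).
  move=> hw; have := qdiff_shift (qdiff_psum hc hw).
  apply: (@qdiff_eq _ _ _ _ _ (r - N (w - z))); first by rewrite subr_gt0.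
  move=> x hx; rewrite h // -(subrK w x) -addrA (le_lt_trans (le_normcD _ _)) //.
  by rewrite -ltrBrDr.
have hz : N (z - z) < r by rewrite subrr normc_0.
split; first by rewrite (qdiff_cderiv (hq z hz)); exact: hq.
exists (psum (dcoef (dcoef c)) (z - z)).
have := qdiff_shift (qdiff_psum (radius_ge_dcoef hc) hz).
apply: (@qdiff_eq _ _ _ _ _ r) => // w hw.
by rewrite (qdiff_cderiv (hq w hw)).
Qed.

Lemma analytic_on_eq (F G : C -> C) : (forall z, disk z -> F z = G z) ->
  analytic_on disk F -> analytic_on disk G.
Proof.
move=> FG hF z /[dup] hz /hF /analytic_atP[c [r [r0 hc h]]].
have [r' r'0 hr'] := disk_ball hz.
apply/analytic_atP; exists c, (Num.min r r'); split; first by rewrite lt_min r0.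
  by move=> x /andP[x0]; rewrite lt_min => /andP[xr _]; apply: hc; rewrite x0.
by move=> w; rewrite lt_min => /andP[wr wr']; rewrite -FG ?h //; exact: hr'.
Qed.

Lemma psum_analytic c : radius_ge c 1 -> analytic_on disk (psum c).
Proof.
move=> hc z; rewrite diskP => hz; have [e he] := power_sum_recenter hc hz.
exists e, (1 - N z); split; first by rewrite subr_gt0.
move=> w; rewrite norm_normcE ltcR => /he.
by rewrite (_ : z + (w - z) = w) // addrC subrK.
Qed.

Lemma analytic_const l : analytic_on disk (fun=> l).
Proof.
move=> z _; exists (fun n => if n is 0 then l else 0), 1; split=> // w _.
apply/power_sumE/(cvgC_shift _ _ 1).1.
rewrite (_ : (fun n => _) = (fun=> l)); first exact: cvgC_cst.
by apply/funext => n; rewrite addn1 big_ord_recl mulr1 big1 ?addr0 // => i _; rewrite mul0r.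
Qed.

Lemma analytic_id : analytic_on disk (@id C).
Proof.
move=> z _; exists (fun n => if n is 0 then z else (if n is 1 then 1 else 0)), 1; split=> // w _.
apply/power_sumE/(cvgC_shift _ _ 2).1.
rewrite (_ : (fun n => _) = (fun=> w)); first exact: cvgC_cst.
apply/funext => n; rewrite addn2 !big_ord_recl mulr1 mul1r big1 ?addr0 => [|i _];
  last by rewrite mul0r.
by rewrite addrC subrK.
Qed.

Lemma analytic_lin (F G : C -> C) a b : analytic_on disk F -> analytic_on disk G ->
  analytic_on disk (fun z => a * F z + b * G z).
Proof.
move=> hF hG z hz.
have [c [r [r0 h]]] := hF z hz; have [c' [r' [r'0 h']]] := hG z hz.
exists (fun n => a * c n + b * c' n), (Num.min r r'); split; first by rewrite lt_min r0.
move=> w; rewrite norm_normcE ltcR lt_min => /andP[wr wr'].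
have /power_sumE k : power_sum c (w - z) (F w) by apply: h; rewrite norm_normcE ltcR.
have /power_sumE k' : power_sum c' (w - z) (G w) by apply: h'; rewrite norm_normcE ltcR.
have := cvgC_D (cvgC_M (cvgC_cst a) k) (cvgC_M (cvgC_cst b) k') => k''.
apply/power_sumE; rewrite (_ : (fun n => _) = (fun n =>
  a * (\sum_(k < n) c k * (w - z) ^+ k) + b * (\sum_(k < n) c' k * (w - z) ^+ k))) //.
apply/funext => n; rewrite !mulr_sumr -big_split /=; apply: eq_bigr => i _; ring.
Qed.

Section DiskSeries.
Variables (F : C -> C) (c : nat -> C).
Hypothesis hF : forall z, disk z -> power_sum c z (F z).

Lemma disk_radius : radius_ge c 1.
Proof. by apply: power_sum_radius => z /diskP/hF h; exists (F z). Qed.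

Lemma disk_psum z : disk z -> F z = psum c z.
Proof. by move=> hz; rewrite (psum_eq (hF hz)). Qed.

Lemma disk_cderiv z : disk z -> cderiv F z = psum (dcoef c) z.
Proof.
move=> hz; apply: qdiff_cderiv; have [r r0 hr] := disk_ball hz.
apply: qdiff_eq (qdiff_psum disk_radius _) => [||]; last by apply/diskP.
  exact: r0.
by move=> w /hr hw; rewrite disk_psum.
Qed.
End DiskSeries.

(** The origin is left out because the second equation of the theorem carries a factor z^m and says
    nothing there. *)
Lemma psum_zero c : radius_ge c 1 -> (forall z, disk z -> z != 0 -> psum c z = 0) ->
  forall n, c n = 0.
Proof.
move=> hc h; apply: (@power_sum_zero _ _ 1) => // z /andP[z0 z1].
rewrite -(h z); [exact: psumP hc z1|exact/diskP|by rewrite -normc_eq0 gt_eqF].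
Qed.

Lemma psum0 c z : (forall n, c n = 0) -> psum c z = 0.
Proof.
move=> h; apply/psum_eq/power_sumE.
rewrite (_ : (fun n => _) = (fun=> 0)); first exact: cvgC_cst.
by apply/funext => n; rewrite big1 // => i _; rewrite h mul0r.
Qed.

Lemma psum_lin c c' a b r z : radius_ge c r -> radius_ge c' r -> N z < r ->
  psum (fun n => a * c n + b * c' n) z = a * psum c z + b * psum c' z.
Proof.
move=> hc hc' hz.
have /power_sumE k := psumP hc hz; have /power_sumE k' := psumP hc' hz.
have := cvgC_D (cvgC_M (cvgC_cst a) k) (cvgC_M (cvgC_cst b) k') => k''.
apply/psum_eq/power_sumE; rewrite (_ : (fun n => _) = (fun n =>
  a * (\sum_(k < n) c k * z ^+ k) + b * (\sum_(k < n) c' k * z ^+ k))) //.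
apply/funext => n; rewrite !mulr_sumr -big_split /=; apply: eq_bigr => i _; ring.
Qed.

End Analytic.

(** * Continuity and measurability in the plane *)

Section PlaneTopology.
Variable R : realType.
Local Notation C := R[i].
Local Notation N := (@Normc.normc R).
Local Notation re := (@complex.Re R).
Local Notation im := (@complex.Im R).
Local Notation plane := (measurableTypeR R * measurableTypeR R)%type.
Implicit Types (z w : C) (u v : C -> R) (p q : R * R).

(** An open set is the union of the countably many rational squares that it contains, and squares
    are measurable rectangles. A radius [ratr q < e / 2] lets a square that contains [p] fit into
    the ball of radius [e] about [p]. *)
Lemma open_plane_measurable (A : set (R * R)) : open A -> measurable (A : set plane).
Proof.
move=> oA.
pose B (s : rat * rat * rat) : set plane :=
  ball (ratr s.1.1 : R) (ratr s.2) `*` ball (ratr s.1.2 : R) (ratr s.2).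
have -> : A = \bigcup_(s : rat * rat * rat) (if `[< B s `<=` A >] then B s else set0).
  apply/seteqP; split=> [p Ap|p [s _]]; last by case: asboolP => // h; exact: h.
  move: (oA); rewrite openE => /(_ _ Ap)/nbhs_ballP[e /= e0 he].
  have /rat_in_itvoo[q /itvP qe] : 0 < e / 2 by rewrite divr_gt0.
  have q0 : 0 < (ratr q : R) by rewrite qe.
  have near_rat (x : R) : exists y : rat, `|ratr y - x| < (ratr q : R).
    have /rat_in_itvoo[y /itvP ye] : x - ratr q < x + ratr q by lra.
    by exists y; rewrite ltr_distl !ye.
  have [[a ha] [b hb]] := (near_rat p.1, near_rat p.2).
  exists (a, b, q) => //=; case: asboolP => [_|]; first by split.
  case=> x [/= xa xb]; apply: he; have qe2 : ratr q < e / 2 by rewrite qe.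
  rewrite /ball /= in xa xb ha hb *.
  split; rewrite /ball /=.
    rewrite -(subrK (ratr a) p.1) -addrA (le_lt_trans (ler_normD _ _)) // [e]splitr.
    by apply: ltrD; apply: lt_trans qe2; rewrite // distrC.
  rewrite -(subrK (ratr b) p.2) -addrA (le_lt_trans (ler_normD _ _)) // [e]splitr.
  by apply: ltrD; apply: lt_trans qe2; rewrite // distrC.
apply: countable_bigcupT_measurable; first exact: countableP.
move=> s; case: asboolP => // _; by apply: measurableX; apply: open_measurable; exact: ball_open.
Qed.

(** Continuity is stated on [R * R], where the integrals live and where restriction to horizontal
    and vertical lines is immediate. *)
Definition cont u z :=
  {for (re z, im z), continuous (fun p : R * R => u (p.1 +i* p.2))}.

Lemma contP u z : (forall e : R, 0 < e -> exists2 d : R, 0 < d &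
   forall w, N (w - z) < d -> `|u w - u z| < e) -> cont u z.
Proof.
move=> h; apply/cvgrPdist_lt => e /h[d d0 hd].
have d20 : 0 < d / 2 by rewrite divr_gt0.
near=> p; rewrite distrC /=.
rewrite (_ : re z +i* im z = z); last by case: (z).
apply: hd; apply: le_lt_trans (normc_le_ReIm _) _.
rewrite Re_add Re_opp Im_add Im_opp /= [d]splitr; apply: ltrD; rewrite distrC.
  near: p; exists (ball (re z) (d / 2), setT) => /=; last by move=> p [].
  by split; [exact: nbhsx_ballx|exact: filterT].
near: p; exists (setT, ball (im z) (d / 2)) => /=; last by move=> p [].
by split; [exact: filterT|exact: nbhsx_ballx].
Unshelve. all: by end_near. Qed.

Lemma cont_measurable (D : set C) u :
  open [set p : R * R | D (p.1 +i* p.2)] -> (forall z, D z -> cont u z) ->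
  measurable_fun ([set p | D (toC p)] : set plane) (fun p => u (toC p)).
Proof.
move=> oD hu.
have mD : measurable ([set p | D (toC p)] : set plane) by exact: open_plane_measurable.
apply: (measurability _ (RGenOpens.measurableE R)) => //.
move=> _ [_ [a [b ->] <-]].
apply: (@open_plane_measurable ([set p : R * R | D (p.1 +i* p.2)] `&` (fun p : R * R => u (p.1
  +i* p.2)) @^-1` `]a, b[)).
rewrite openE => p [Dp up]; apply: filterI.
  by move: oD; rewrite openE; exact.
have cp := hu _ Dp; rewrite /cont /= in cp.
apply: cp; apply: open_nbhs_nbhs; split; first exact: interval_open.
exact: up.
Qed.

End PlaneTopology.

(** * Integrals of partial derivatives over disks *)

Section Green.
Variable R : realType.
Local Notation C := R[i].
Local Notation N := (@Normc.normc R).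
Local Notation re := (@complex.Re R).
Local Notation im := (@complex.Im R).
Local Notation plane := (measurableTypeR R * measurableTypeR R)%type.
Local Notation leb := (@lebesgue_measure R).
Implicit Types (z w : C) (u v : C -> R) (p q : R * R).

Lemma normc_ltE z (r : R) : 0 <= r -> (N z < r) = (re z ^+ 2 + im z ^+ 2 < r ^+ 2).
Proof. by move=> r0; rewrite -sqr_normcE ltr_pXn2r // nnegrE normc_ge0. Qed.

Lemma normc_eqE z (r : R) : 0 <= r -> (N z == r) = (re z ^+ 2 + im z ^+ 2 == r ^+ 2).
Proof. by move=> r0; rewrite -sqr_normcE eqrXn2 // normc_ge0. Qed.

(** The set is an interval []-s, s[] with [s] the square root of r^2 - b^2, or empty, and the
    fundamental theorem of calculus gives f(s) - f(-s) = 0. Differentiability is assumed up to the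
    end points to have continuity on the closed chord. *)
Lemma integral_chord0 (f df : R -> R) (b r : R) :
  (forall t, t ^+ 2 + b ^+ 2 <= r ^+ 2 ->
     is_derive t (1:R) f (df t) /\ {for t, continuous df}) ->
  (forall t, t ^+ 2 + b ^+ 2 = r ^+ 2 -> f t = 0) ->
  (\int[leb]_(t in [set t | (t ^+ 2 + b ^+ 2 < r ^+ 2)%R]) (df t)%:E = 0)%E.
Proof.
move=> hf h0; have [rb|br] := leP (r ^+ 2) (b ^+ 2).
  rewrite (_ : [set t | _] = set0) ?integral_set0 //.
  apply/seteqP; split=> // t /=; rewrite ltNge => /negP; apply.
  by rewrite (le_trans rb) // lerDr sqr_ge0.
pose s := Num.sqrt (r ^+ 2 - b ^+ 2).
have s0 : 0 < s by rewrite sqrtr_gt0 subr_gt0.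
have s2 : s ^+ 2 = r ^+ 2 - b ^+ 2 by rewrite sqr_sqrtr // subr_ge0 ltW.
have ins t : t \in `[- s, s] -> t ^+ 2 + b ^+ 2 <= r ^+ 2.
  rewrite in_itv /= -ler_norml => ts.
  by rewrite -lerBrDr -s2 -real_normK ?num_real // lerXn2r ?nnegrE // ltW.
have -> : [set t | t ^+ 2 + b ^+ 2 < r ^+ 2] = `]- s, s[%classic.
  apply/seteqP; split=> t /=; rewrite in_itv /= -ltr_norml -ltrBrDr -s2 -real_normK ?num_real //.
    by rewrite ltr_pXn2r // nnegrE ltW.
  by move=> ?; rewrite ltr_pXn2r // nnegrE ltW.
have cdf : {within `[- s, s], continuous df}.
  by apply: continuous_in_subspaceT => t /[!inE]/= /ins/hf[].
have ss : - s < s by lra.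
have hd t : t \in `[- s, s] -> is_derive t (1:R) f (df t) by move/ins/hf => [].
rewrite -(@integral_itv_bndoo _ _ _ _ true false); last first.
  apply/measurable_EFinP; apply: open_continuous_measurable_fun; first exact: interval_open.
  by move=> t /[!inE]/= /subset_itv_oo_cc/ins/hf[].
rewrite (continuous_FTC2 ss cdf (F := f)).
- rewrite !h0 ?subee // ?sqrrN s2 ?subrK //.
- have cf t : t \in `[- s, s] -> {for t, continuous f}.
    move=> /hd h; apply: differentiable_continuous; apply/derivable1_diffP.
    exact: ex_derive.
  split=> [t /subset_itv_oo_cc/hd h||].
  + exact: ex_derive.
  + by apply: cvg_at_right_filter; apply: cf; rewrite in_itv /= lexx ltW.
  + by apply: cvg_at_left_filter; apply: cf; rewrite in_itv /= lexx ltW.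
- by move=> t /subset_itv_oo_cc/hd h; rewrite derive1E derive_val.
Qed.

Definition pball (r : R) : set plane := [set p | N (toC p) < r].

Lemma cont_normc z : cont N z.
Proof. by apply: contP => e e0; exists e => // w; apply: le_lt_trans (ler_dist_normc _ _). Qed.

Lemma open_normc_lt (r : R) : open [set p : R * R | N (p.1 +i* p.2) < r].
Proof.
rewrite openE => p /= hp.
have := @cont_normc (p.1 +i* p.2); rewrite /cont /= => /cvgrPdist_lt.
move=> /(_ (r - N (p.1 +i* p.2))); rewrite subr_gt0 => /(_ hp).
case: p hp => a b hp; apply: filterS => q /=.
by rewrite distrC ltr_distl => /andP[_ h]; lra.
Qed.

Lemma measurable_pball r : measurable (pball r).
Proof. exact: open_plane_measurable (@open_normc_lt r). Qed.

Lemma pdisk_pball : @pdisk R = pball 1.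
Proof. by apply/seteqP; split=> p /= => /diskP. Qed.

(** The closed disk of radius [r < 1] is compact and lies inside the open unit disk. *)
Lemma cont_bounded u (r : R) : r < 1 -> (forall z, disk z -> cont u z) ->
  exists M, forall z, N z <= r -> `|u z| <= M.
Proof.
move=> r1 hu.
pose A := [set p : R * R | N (p.1 +i* p.2) <= r].
have cA : compact A.
  apply: (@subclosed_compact _ _ (`[- r, r] `*` `[- r, r])).
  - rewrite (_ : A = (fun p : R * R => N (p.1 +i* p.2)) @^-1` `]-oo, r]%classic).
      apply: preimage_closed; last exact: interval_closed.
      by move=> [a b] _; exact: (@cont_normc (a +i* b)).
    by apply/seteqP; split=> p; rewrite /A /= in_itv.
  - by apply: compact_setX; exact: segment_compact.
  - move=> p /= hp; split=> /=; rewrite in_itv /= -ler_norml; apply: le_trans hp.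
      exact: (normr_Re_le (p.1 +i* p.2)).
    exact: (normr_Im_le (p.1 +i* p.2)).
have cu : {within A, continuous (fun p : R * R => u (p.1 +i* p.2))}.
  apply: continuous_in_subspaceT => -[a b]; rewrite inE /A /= => h.
  by apply: (hu (a +i* b)); apply/diskP; exact: le_lt_trans h r1.
have [M [_ hM]] := compact_bounded (continuous_compact cu cA).
exists (M + 1) => z hz; apply: (hM (M + 1)); first by rewrite ltrDl.
by exists (re z, im z); case: z hz.
Qed.

(** The measure is a parameter because the lemma serves both the product Lebesgue measure, to which
    Fubini applies, and its normalization [dA]. *)
Lemma integrable_pball (mu : {measure set plane -> \bar R}) u (r : R) :
  (mu (pball 1) < +oo)%E -> r < 1 ->
  (forall z, disk z -> cont u z) -> mu.-integrable (pball r) (EFin \o (fun p => u (toC p))).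
Proof.
move=> mu1 r1 hu; apply: measurable_bounded_integrable.
- exact: measurable_pball.
- apply: le_lt_trans mu1; apply: le_measure; rewrite ?inE; try exact: measurable_pball.
  by move=> p /= h; exact: lt_trans h r1.
- apply: (@cont_measurable _ [set z | N z < r]); first exact: open_normc_lt.
  by move=> z /= hz; apply: hu; apply/diskP; exact: lt_trans hz r1.
- have [M hM] := cont_bounded r1 hu.
  exists M; split; first exact: num_real.
  move=> x Mx p /= hp; apply: le_trans (ltW Mx); apply: hM; exact: ltW.
Qed.

Lemma measurable_fun_pball1 u : (forall z, disk z -> cont u z) ->
  measurable_fun (pball 1) (fun p => u (toC p)).
Proof.
move=> hu; apply: (@cont_measurable _ [set z | N z < 1]); first exact: open_normc_lt.
by move=> z /= /diskP; exact: hu.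
Qed.

Let leb2 : {measure set plane -> \bar R} := (leb \x leb)%E.

Lemma leb2_pball1 : (leb2 (pball 1) < +oo)%E.
Proof.
apply: (@le_lt_trans _ _ (leb2 (`[-1, 1] `*` `[-1, 1]))).
  apply: le_measure; rewrite ?inE.
  - exact: measurable_pball.
  - by apply: measurableX; exact: measurable_itv.
  - move=> p /= /ltW hp; split=> /=; rewrite in_itv /= -ler_norml; apply: le_trans hp.
      exact: (normr_Re_le (toC p)).
    exact: (normr_Im_le (toC p)).
have -> : (leb2 (`[(-1)%R, 1%R] `*` `[(-1)%R, 1%R]) = leb `[(-1)%R, 1%R] * leb `[(-1)%R, 1%R])%E.
  by apply: product_measure1E; exact: measurable_itv.
have -> : leb `[(-1)%R, 1%R] = (1 - -1)%:E.
  by rewrite lebesgue_measure_itv /= lte_fin ifT ?EFinB //; lra.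
by rewrite -EFinM ltry.
Qed.

Lemma cont_linex u (x y : R) : cont u (x +i* y) ->
  {for x, continuous (fun t => u (t +i* y))}.
Proof.
by move=> h; apply: (@continuous2_cvg _ R R R (nbhs x) _ id (fun=> y) (fun a b => u (a +i* b)));
  [exact: h|exact: cvg_id|exact: cvg_cst].
Qed.

Lemma cont_liney u (x y : R) : cont u (x +i* y) ->
  {for y, continuous (fun t => u (x +i* t))}.
Proof.
by move=> h; apply: (@continuous2_cvg _ R R R (nbhs y) _ (fun=> x) id (fun a b => u (a +i* b)));
  [exact: h|exact: cvg_cst|exact: cvg_id].
Qed.

(** By Fubini the integral is taken along horizontal chords, and each chord contributes 0 since its
    end points lie on the circle where [u] vanishes. Taking [r < 1] keeps the closed chords inside
    the disk and makes [ux] integrable. *)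
Lemma integral_dx0 u ux (r : R) : 0 <= r < 1 ->
  (forall z, disk z -> is_derive (re z) (1:R) (fun t => u (t +i* im z)) (ux z)) ->
  (forall z, disk z -> cont ux z) -> (forall z, N z = r -> u z = 0) ->
  (\int[leb2]_(p in pball r) (ux (toC p))%:E = 0)%E.
Proof.
move=> /andP[r0 r1] hu hux u0.
have i1 := integrable_pball leb2_pball1 r1 hux.
rewrite integral_mkcond -integral21_prod_meas1; last first.
  by rewrite integrable_mkcond in i1 => //; exact: measurable_pball.
apply: integral0_eq => y _; rewrite /fubini_G.
rewrite -[RHS](@integral_chord0 (fun t => u (t +i* y)) (fun t => ux (t +i* y)) y r).
- rewrite [RHS]integral_mkcond; apply: eq_integral => x _.
  rewrite !patchE; congr (if _ then _ else _).
  by apply/idP/idP; rewrite !inE /pball /= -/(N (x +i* y)) normc_ltE.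
- move=> t ht; have dt : disk (t +i* y).
    apply/diskP; apply: le_lt_trans r1.
    by rewrite -(ler_pXn2r (n := 2)) ?nnegrE ?normc_ge0 // sqr_normcE.
  by split; [exact: (hu _ dt)|apply: cont_linex; exact: (hux _ dt)].
- move=> t ht; apply: u0; apply/eqP; rewrite normc_eqE //; exact/eqP.
Qed.

Lemma integral_dy0 u uy (r : R) : 0 <= r < 1 ->
  (forall z, disk z -> is_derive (im z) (1:R) (fun t => u (re z +i* t)) (uy z)) ->
  (forall z, disk z -> cont uy z) -> (forall z, N z = r -> u z = 0) ->
  (\int[leb2]_(p in pball r) (uy (toC p))%:E = 0)%E.
Proof.
move=> /andP[r0 r1] hu huy u0.
have i1 := integrable_pball leb2_pball1 r1 huy.
rewrite integral_mkcond -integral12_prod_meas1; last first.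
  by rewrite integrable_mkcond in i1 => //; exact: measurable_pball.
apply: integral0_eq => x _; rewrite /fubini_F.
rewrite -[RHS](@integral_chord0 (fun t => u (x +i* t)) (fun t => uy (x +i* t)) x r).
- rewrite [RHS]integral_mkcond; apply: eq_integral => y _.
  rewrite !patchE; congr (if _ then _ else _).
  by apply/idP/idP; rewrite !inE /pball /= -/(N (x +i* y)) normc_ltE //= addrC.
- move=> t ht; have dt : disk (x +i* t).
    apply/diskP; apply: le_lt_trans r1.
    by rewrite -(ler_pXn2r (n := 2)) ?nnegrE ?normc_ge0 // sqr_normcE addrC.
  by split; [exact: (hu _ dt)|apply: cont_liney; exact: (huy _ dt)].
- by move=> t ht; apply: u0; apply/eqP; rewrite normc_eqE //= addrC; exact/eqP.
Qed.

End Green.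

(** * The d-bar operator *)

Section Dbar.
Variable R : realType.
Local Notation C := R[i].
Local Notation N := (@Normc.normc R).
Local Notation re := (@complex.Re R).
Local Notation im := (@complex.Im R).
Local Notation plane := (measurableTypeR R * measurableTypeR R)%type.
Local Notation leb := (@lebesgue_measure R).
Implicit Types (z w : C) (u v : C -> R) (F G D E : C -> C).

Lemma is_derive_quadratic (f : R -> R) (x l K e : R) : 0 < e ->
  (forall s, `|s - x| < e -> `|f s - f x - (s - x) * l| <= K * `|s - x| ^+ 2) ->
  is_derive x (1 : R) f l.
Proof.
move=> e0 h.
have hl : (fun t => t^-1 *: (f (t *: 1 + x) - f x) : R) @ 0^' --> l.
  apply/cvgrPdist_lt => eps eps0.
  have K1 : 0 < `|K| + 1 by rewrite ltr_wpDl.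
  exists (Num.min e (eps / (`|K| + 1))) => /=; first by rewrite lt_min e0 divr_gt0.
  move=> t /= ; rewrite sub0r normrN lt_min => /andP[te td] t0.
  have Nt : 0 < `|t| by rewrite normr_gt0.
  have := h (t *: 1 + x); rewrite [t *: 1]mulr1 addrK => /(_ te) {}h.
  have -> : l - t^-1 *: (f (t + x) - f x) = - (t^-1 * (f (t + x) - f x - t * l)).
    by rewrite [in RHS]mulrBr mulKf // opprB.
  rewrite normrN normrM normfV mulrC ltr_pdivrMr // (le_lt_trans h) // expr2 mulrA.
  rewrite ltr_pM2r //; apply: (@le_lt_trans _ _ ((`|K| + 1) * `|t|)).
    by rewrite ler_wpM2r // (le_trans (ler_norm _)) // lerDl.
  by rewrite mulrC -ltr_pdivlMr.
have hc : derivable f x 1 by apply/cvg_ex; exists l.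
by apply: DeriveDef => //; apply: cvg_lim.
Qed.

(** The partial derivatives along the axes and their continuity are what the chord integrals need;
    continuity of [u] itself is included to make the class closed under products. *)
Definition rC1 u ux uy := forall z, disk z ->
  [/\ is_derive (re z) (1 : R) (fun t => u (t +i* im z)) (ux z),
      is_derive (im z) (1 : R) (fun t => u (re z +i* t)) (uy z),
      cont u z, cont ux z & cont uy z].

Lemma contD u v z : cont u z -> cont v z -> cont (fun w => u w + v w) z.
Proof. exact: cvgD. Qed.
Lemma contN u z : cont u z -> cont (fun w => - u w) z.
Proof. exact: cvgN. Qed.
Lemma contM u v z : cont u z -> cont v z -> cont (fun w => u w * v w) z.
Proof. exact: cvgM. Qed.
Lemma contB u v z : cont u z -> cont v z -> cont (fun w => u w - v w) z.
Proof. exact: cvgB. Qed.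

Lemma rC1_D u ux uy v vx vy : rC1 u ux uy -> rC1 v vx vy ->
  rC1 (fun w => u w + v w) (fun w => ux w + vx w) (fun w => uy w + vy w).
Proof.
move=> hu hv z hz; have [a b c d e] := hu z hz; have [a' b' c' d' e'] := hv z hz.
by split; [exact: is_deriveD|exact: is_deriveD|exact: contD|exact: contD|exact: contD].
Qed.

Lemma rC1_N u ux uy : rC1 u ux uy ->
  rC1 (fun w => - u w) (fun w => - ux w) (fun w => - uy w).
Proof.
move=> hu z hz; have [a b c d e] := hu z hz.
by split; [exact: is_deriveN|exact: is_deriveN|exact: contN|exact: contN|exact: contN].
Qed.

Lemma rC1_M u ux uy v vx vy : rC1 u ux uy -> rC1 v vx vy ->
  rC1 (fun w => u w * v w) (fun w => u w * vx w + v w * ux w)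
      (fun w => u w * vy w + v w * uy w).
Proof.
move=> hu hv z hz; have [a b c d e] := hu z hz; have [a' b' c' d' e'] := hv z hz.
have hz' : re z +i* im z = z by case: (z).
split; [|
  |exact: contM|by apply: contD; exact: contM|by apply: contD; exact: contM].
- by have := is_deriveM a a'; rewrite /= hz'.
- by have := is_deriveM b b'; rewrite /= hz'.
Qed.

Lemma qdiff_contRe F z l : qdiff F z l -> cont (fun w => re (F w)) z.
Proof.
move=> /qdiff_cont h; apply: contP => e /h[d d0 hd]; exists d => // w /hd.
by apply: le_lt_trans; rewrite -Re_opp -Re_add normr_Re_le.
Qed.
Lemma qdiff_contIm F z l : qdiff F z l -> cont (fun w => im (F w)) z.
Proof.
move=> /qdiff_cont h; apply: contP => e /h[d d0 hd]; exists d => // w /hd.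
by apply: le_lt_trans; rewrite -Im_opp -Im_add normr_Im_le.
Qed.

(** The Cauchy-Riemann equations: a real increment [s] changes F by about [s * l], an imaginary one
    by about [s * 'i * l]. *)
Lemma qdiff_partial F z l : qdiff F z l ->
  [/\ is_derive (re z) (1 : R) (fun t => re (F (t +i* im z))) (re l),
      is_derive (im z) (1 : R) (fun t => re (F (re z +i* t))) (- im l),
      is_derive (re z) (1 : R) (fun t => im (F (t +i* im z))) (im l) &
      is_derive (im z) (1 : R) (fun t => im (F (re z +i* t))) (re l)].
Proof.
case: z => x y [K [e [e0 h]]] /=.
have hx t : t +i* y - (x +i* y) = (t - x)%:C.
  by rewrite -[LHS]/((t - x) +i* (y - y)) subrr.
have hy t : x +i* t - (x +i* y) = 0 +i* (t - y).
  by rewrite -[LHS]/((x - x) +i* (t - y)) subrr.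
have Ny (s : R) : N (0 +i* s) = `|s| by rewrite /= expr0n add0r sqrtr_sqr.
split; apply: (is_derive_quadratic (K := K) e0) => t ht.
- have := h (t +i* y); rewrite hx normc_real => /(_ ht); apply: le_trans;
  apply: le_trans (normr_Re_le _).
  by rewrite Re_add Re_opp Re_add Re_opp Re_mul /= mul0r subr0.
- have := h (x +i* t); rewrite hy Ny => /(_ ht); apply: le_trans; apply: le_trans (normr_Re_le _).
  by rewrite Re_add Re_opp Re_add Re_opp Re_mul /= mul0r add0r mulrN.
- have := h (t +i* y); rewrite hx normc_real => /(_ ht); apply: le_trans;
  apply: le_trans (normr_Im_le _).
  by rewrite Im_add Im_opp Im_add Im_opp Im_mul /= mul0r addr0.
- have := h (x +i* t); rewrite hy Ny => /(_ ht); apply: le_trans; apply: le_trans (normr_Im_le _).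
  by rewrite Im_add Im_opp Im_add Im_opp Im_mul /= mul0r add0r.
Qed.

Lemma analytic_rC1 F : analytic_on disk F ->
  rC1 (fun w => re (F w)) (fun w => re (cderiv F w)) (fun w => - im (cderiv F w)) /\
  rC1 (fun w => im (F w)) (fun w => im (cderiv F w)) (fun w => re (cderiv F w)).
Proof.
move=> hF; split=> z /hF/analytic_qdiff[hq [l hl]]; have [a b c d] := qdiff_partial hq.
- split=> //; [exact: qdiff_contRe hq|exact: qdiff_contRe hl|apply: contN;
  exact: qdiff_contIm hl].
- split=> //; [exact: qdiff_contIm hq|exact: qdiff_contIm hl|exact: qdiff_contRe hl].
Qed.

(* [has_dbar F D]: F is C^1 on the disk and D = dF/dx + i dF/dy there, i.e. twice
   the Wirtinger derivative of F with respect to the conjugate variable. *)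
Definition has_dbar F D := exists ux uy vx vy,
  [/\ rC1 (fun w => re (F w)) ux uy, rC1 (fun w => im (F w)) vx vy &
      forall z, disk z -> D z = (ux z - vy z) +i* (vx z + uy z)].

Lemma has_dbar_analytic F : analytic_on disk F -> has_dbar F (fun=> 0).
Proof.
move=> /analytic_rC1[h1 h2]; do 4 eexists; split; [exact: h1|exact: h2|].
by move=> z _; rewrite !subrr.
Qed.

(** The factor 2 reflects that [has_dbar] is twice the Wirtinger derivative; the [2^-1] in
    [dbar_identity] cancels it. *)
Lemma has_dbar_conj F : analytic_on disk F ->
  has_dbar (fun z => (F z)^*) (fun z => 2 * (cderiv F z)^*).
Proof.
move=> /analytic_rC1[h1 /rC1_N h2]; do 4 eexists; split.
- have -> : (fun w => re (F w)^*) = (fun w => re (F w)) by apply/funext => w; case: (F w).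
  exact: h1.
- have -> : (fun w => im (F w)^*) = (fun w => - im (F w)) by apply/funext => w; case: (F w).
  exact: h2.
- move=> z _ /=; case: (cderiv F z) => a b /=.
  by rewrite mulr_natl mulr2n; simpc; rewrite -opprD.
Qed.

Lemma has_dbarD F D G E : has_dbar F D -> has_dbar G E ->
  has_dbar (fun z => F z + G z) (fun z => D z + E z).
Proof.
move=> [ux [uy [vx [vy [hu hv hD]]]]] [ux' [uy' [vx' [vy' [hu' hv' hE]]]]].
do 4 eexists; split.
- under [X in rC1 X]eq_fun do rewrite Re_add.
  exact: rC1_D hu hu'.
- under [X in rC1 X]eq_fun do rewrite Im_add.
  exact: rC1_D hv hv'.
- by move=> z hz; rewrite hD // hE //; simpc; congr Complex; ring.
Qed.

Lemma has_dbarM F D G E : has_dbar F D -> has_dbar G E ->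
  has_dbar (fun z => F z * G z) (fun z => D z * G z + F z * E z).
Proof.
move=> [ux [uy [vx [vy [hu hv hD]]]]] [ux' [uy' [vx' [vy' [hu' hv' hE]]]]].
do 4 eexists; split.
- under [X in rC1 X]eq_fun do rewrite Re_mul.
  exact: rC1_D (rC1_M hu hu') (rC1_N (rC1_M hv hv')).
- under [X in rC1 X]eq_fun do rewrite Im_mul.
  exact: rC1_D (rC1_M hu hv') (rC1_M hv hu').
- move=> z hz; rewrite hD // hE //; case: (F z) => a b; case: (G z) => c d /=.
  by simpc; congr Complex; ring.
Qed.

Local Notation leb2 := ((leb \x leb)%E : {measure set plane -> \bar R}).

(** Both real components of F vanish on the circle, so each of the four partial derivatives that
    make up D has integral 0 separately. *)
Lemma dbar_integral0 F D (r : R) : has_dbar F D -> 0 <= r < 1 ->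
  (forall z, N z = r -> F z = 0) ->
  (\int[leb2]_(p in pball r) (re (D (toC p)))%:E = 0)%E /\
  (\int[leb2]_(p in pball r) (im (D (toC p)))%:E = 0)%E.
Proof.
move=> [ux [uy [vx [vy [hu hv hD]]]]] r01 F0.
have r1 : r < 1 by case/andP: r01.
have pd p : pball r p -> disk (toC p) by move=> h; apply/diskP; exact: lt_trans h r1.
have iu : forall v, (forall z, disk z -> cont v z) ->
    leb2.-integrable (pball r) (EFin \o (fun p => v (toC p))).
  by move=> v hv'; exact: (integrable_pball (leb2_pball1 R) r1 hv').
have u0 : forall z, N z = r -> re (F z) = 0 by move=> z /F0 ->.
have v0 : forall z, N z = r -> im (F z) = 0 by move=> z /F0 ->.
split.
- rewrite (eq_integral (fun p => (ux (toC p))%:E - (vy (toC p))%:E)%E); last first.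
    by move=> p /[!inE] /pd hp; rewrite hD.
  rewrite integralB //; [|exact: measurable_pball|by apply: iu => z /hu[]|by apply: iu => z
    /hv[]].
  rewrite (integral_dx0 r01 _ _ u0) ?(integral_dy0 r01 _ _ v0) ?sube0 //.
  1-4: by move=> z; first [by move=> /hu[]|by move=> /hv[]].
- rewrite (eq_integral (fun p => (vx (toC p))%:E + (uy (toC p))%:E)%E); last first.
    by move=> p /[!inE] /pd hp; rewrite hD.
  rewrite integralD //; [|exact: measurable_pball|by apply: iu => z /hv[]|by apply: iu => z
    /hu[]].
  rewrite (integral_dx0 r01 _ _ v0) ?(integral_dy0 r01 _ _ u0) ?adde0 //.
  all: by move=> z; first [by move=> /hu[]|by move=> /hv[]].
Qed.

End Dbar.

(** * The d-bar primitive of the projected function *)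

Section KeyIdentity.
Variable R : realType.
Local Notation C := R[i].
Local Notation N := (@Normc.normc R).
Local Notation re := (@complex.Re R).
Local Notation im := (@complex.Im R).
Local Notation plane := (measurableTypeR R * measurableTypeR R)%type.
Local Notation leb := (@lebesgue_measure R).
Local Notation leb2 := ((leb \x leb)%E : {measure set plane -> \bar R}).
Implicit Types (z w : C) (u v : C -> R) (F G D E : C -> C).

Lemma has_dbar_eq F D D' : (forall z, disk z -> D z = D' z) ->
  has_dbar F D -> has_dbar F D'.
Proof.
move=> h [ux [uy [vx [vy [hu hv hD]]]]]; exists ux, uy, vx, vy; split=> //.
by move=> z hz; rewrite -h // hD.
Qed.

Lemma has_dbar_cst (l : C) : has_dbar (fun=> l) (fun=> 0).
Proof. exact: has_dbar_analytic (analytic_const l). Qed.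

Lemma has_dbarZ l F D : has_dbar F D -> has_dbar (fun z => l * F z) (fun z => l * D z).
Proof.
move=> hF; apply: has_dbar_eq (has_dbarM (has_dbar_cst l) hF) => z _.
by rewrite mul0r add0r.
Qed.

Lemma has_dbar_expr n : has_dbar (fun z => z ^+ n) (fun=> 0).
Proof.
elim: n => [|n IH]; first exact: has_dbar_cst.
under eq_fun do rewrite exprS.
apply: has_dbar_eq (has_dbarM (has_dbar_analytic (@analytic_id R)) IH) => z _.
by rewrite mul0r mulr0 addr0.
Qed.

Lemma has_dbar_sum n (F : nat -> C -> C) : (forall i, has_dbar (F i) (fun=> 0)) ->
  has_dbar (fun z => \sum_(i < n) F i z) (fun=> 0).
Proof.
move=> hF; elim: n => [|n IH].
  by under eq_fun do rewrite big_ord0; exact: has_dbar_cst.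
under eq_fun do rewrite big_ord_recr /=.
by apply: has_dbar_eq (has_dbarD IH (hF n)) => z _; rewrite addr0.
Qed.

Variables (m : nat) (d : nat -> C).
Hypothesis hd : radius_ge d 1.

(* The projection of conj(z)^m z^n is (n-m+1)/(n+1) z^(n-m) if n >= m, and 0 otherwise. *)
Definition pcoef k : C := k.+1%:R / (m + k).+1%:R * d (m + k)%N.

Let Gc n : C := if n is n'.+1 then n'.+1%:R^-1 * d n' else 0.
(** For [n > 0] this is [Gc (m + n)]: the primitive of g with its degrees lowered by [m]. Its
    derived sequence is [pcoef]. *)
Let Hc n : C := if n is n'.+1 then (m + n').+1%:R^-1 * d (m + n')%N else 0.

Lemma normc_invn_le1 n : N (n.+1%:R^-1) <= 1.
Proof. by rewrite Normc.normcV normc_nat invf_le1 ?ler1n ?ltr0n. Qed.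

Lemma radius_ge_addl : radius_ge (fun k => d (m + k)%N) 1.
Proof. by under [X in radius_ge X]eq_fun do rewrite addnC; exact: radius_ge_shift. Qed.

Lemma radius_ge_pcoef : radius_ge pcoef 1.
Proof.
apply: (radius_ge_le (K := 1)) radius_ge_addl => k;
  rewrite /pcoef Normc.normcM mul1r ler_piMl ?normc_ge0 //.
by rewrite Normc.normcM normc_nat Normc.normcV normc_nat ler_pdivrMr ?ltr0n // mul1r ler_nat
  ltnS leq_addl.
Qed.

Let hGc : radius_ge Gc 1.
Proof.
apply: radius_ge_unshift; apply: (radius_ge_le (K := 1)) hd => k.
by rewrite Normc.normcM ler_wpM2r ?normc_ge0 // normc_invn_le1.
Qed.

Let hHc : radius_ge Hc 1.
Proof.
apply: radius_ge_unshift; apply: (radius_ge_le (K := 1)) radius_ge_addl => k.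
by rewrite Normc.normcM ler_wpM2r ?normc_ge0 // normc_invn_le1.
Qed.

Let dGc : dcoef Gc = d.
Proof. by apply/funext => n; rewrite /dcoef /= mulrA divff ?mul1r // pnatr_eq0. Qed.

Let dHc : dcoef Hc = pcoef.
Proof. by apply/funext => n; rewrite /dcoef /= mulrA. Qed.

(** The head includes degree [m] because [Hc 0 = 0]; from degree [m + 1] on, the coefficients of G
    are those of z^m H. *)
Let GH z : disk z -> psum Gc z = \sum_(i < m.+1) Gc i * z ^+ i + z ^+ m * psum Hc z.
Proof.
move=> /diskP hz; rewrite (psum_split m.+1 hGc hz) (psum_split 1 hHc hz).
rewrite big_ord1 mul0r add0r mulrA -exprD addn1 (@eq_psum _ _ (fun n => Hc (n + 1)%N)) //.
by move=> n; rewrite addnS addn1 /= addnC.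
Qed.

Lemma mul_conj_normc z : z * z^* = (N z ^+ 2)%:C.
Proof. by case: z => a b; rewrite sqr_normcE /=; simpc; congr Complex; ring. Qed.

Lemma dbar_identity (k : C -> C) (r : R) : analytic_on disk k -> 0 <= r < 1 ->
  let D z := k z * (z ^+ m * (psum d z)^* - (r ^+ (2 * m))%:C * (psum pcoef z)^*) in
  (\int[leb2]_(p in pball r) (re (D (toC p)))%:E = 0)%E /\
  (\int[leb2]_(p in pball r) (im (D (toC p)))%:E = 0)%E.
Proof.
move=> hk /[dup] r01 /andP[r0 r1] D.
pose q : C := (r ^+ (2 * m))%:C.
(* The last sum is what the head of [GH] becomes on the circle: z^m conj(z)^i = r^(2i) z^(m-i) for i
   <= m. As a polynomial in [z] it contributes nothing to the d-bar derivative. *)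
pose F z := 2^-1 * k z * (z ^+ m * (psum Gc z)^* + - q * (psum Hc z)^* +
  (-1) * \sum_(i < m.+1) ((Gc i)^* * (r ^+ (2 * i))%:C) * z ^+ (m - i)).
have derivG z : disk z -> cderiv (psum Gc) z = psum d z.
  by move=> hz; rewrite (disk_cderiv (c := Gc)) ?dGc // => w /diskP; exact: psumP hGc.
have derivH z : disk z -> cderiv (psum Hc) z = psum pcoef z.
  by move=> hz; rewrite (disk_cderiv (c := Hc)) ?dHc // => w /diskP; exact: psumP hHc.
have hF : has_dbar F D.
  have hp : has_dbar (fun z => \sum_(i < m.+1) ((Gc i)^* * (r ^+ (2 * i))%:C) * z ^+ (m - i))
    (fun=> 0).
    apply: (@has_dbar_sum _ (fun i z => ((Gc i)^* * (r ^+ (2 * i))%:C) * z ^+ (m - i))) => i.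
    by apply: has_dbar_eq (has_dbarZ _ (has_dbar_expr (m - i))) => z _; rewrite mulr0.
  have hG := has_dbarM (has_dbar_expr m) (has_dbar_conj (psum_analytic hGc)).
  have hH := has_dbarZ (- q) (has_dbar_conj (psum_analytic hHc)).
  have hk2 := has_dbarZ 2^-1 (has_dbar_analytic hk).
  have := has_dbarM hk2 (has_dbarD (has_dbarD hG hH) (has_dbarZ (-1) hp)).
  apply: has_dbar_eq => z hz; rewrite /D derivG // derivH // -/q.
  have two : 2 != 0 :> C by rewrite pnatr_eq0.
  by field.
have F0 z : N z = r -> F z = 0.
  move=> hz; have dz : disk z by apply/diskP; rewrite hz.
  have hzz i : (i <= m)%N -> z ^+ m * (z ^+ i)^* = (r ^+ (2 * i))%:C * z ^+ (m - i).
    (* Here [i] of the [m] factors [z] pair with conjugates into r^2 each. *)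
    move=> im; rewrite -{1}(subnK im) exprD -mulrA rmorphXn -exprMn_comm; last exact: mulrC.
    by rewrite mul_conj_normc hz -rmorphXn -exprM mulrC.
  have E : (psum Gc z)^* = \sum_(i < m.+1) (Gc i)^* * (z ^+ i)^* + (z ^+ m)^* * (psum Hc z)^*.
    rewrite GH // rmorphD rmorph_sum [in X in _ + X]rmorphM; congr (_ + _).
    by apply: eq_bigr => i _; rewrite rmorphM.
  have {}E : z ^+ m * (psum Gc z)^* =
      \sum_(i < m.+1) ((Gc i)^* * (r ^+ (2 * i))%:C) * z ^+ (m - i) + q * (psum Hc z)^*.
    rewrite E mulrDr mulr_sumr mulrA hzz // subnn mulr1; congr (_ + _).
    by apply: eq_bigr => i _; rewrite mulrCA hzz ?mulrA // -ltnS.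
  by rewrite /F E; ring.
exact: dbar_integral0 hF r01 F0.
Qed.

End KeyIdentity.

(** * Area integrals *)

Section AreaMeasure.
Variable R : realType.
Local Notation C := R[i].
Local Notation N := (@Normc.normc R).
Local Notation re := (@complex.Re R).
Local Notation im := (@complex.Im R).
Local Notation plane := (measurableTypeR R * measurableTypeR R)%type.
Local Notation leb := (@lebesgue_measure R).
Local Notation leb2 := ((leb \x leb)%E : {measure set plane -> \bar R}).
Local Notation mu := (@dA R).
Implicit Types (z w : C) (u v : C -> C) (f : plane -> R).

(** A zero integral of an integrable function says that its positive and negative parts have equal
    finite integrals. Scaling the measure is applied to these two nonnegative functions
    separately. *)
Lemma dA_integral0 (D : set plane) f : measurable D -> leb2.-integrable D (EFin \o f) ->
  (\int[leb2]_(p in D) (f p)%:E = 0)%E -> (\int[mu]_(p in D) (f p)%:E = 0)%E.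
Proof.
move=> mD fi; have mf : measurable_fun D (EFin \o f) by apply: (measurable_int leb2).
rewrite integralE => h0; rewrite integralE.
have [fp fn] := (integrable_pos_fin_num mD fi, integrable_neg_fin_num mD fi).
have e : (\int[leb2]_(p in D) (fun p => (f p)%:E)^\+ p =
    \int[leb2]_(p in D) (fun p => (f p)%:E)^\- p)%E.
  move: h0; rewrite -(fineK fp) -(fineK fn) -EFinB => -[] /eqP.
  by rewrite subr_eq0 => /eqP ->.
rewrite !ge0_integral_mscale //; [|exact: measurable_funeneg|exact: measurable_funepos].
by rewrite e subee // fin_numM.
Qed.

Lemma dA_pball1 : (mu (pball 1) < +oo)%E.
Proof.
have := leb2_pball1 R; rewrite /dA /mscale /= => h.
by apply: lte_mul_pinfty => //; rewrite lee_fin invpi_ge0.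
Qed.

(** The offset 2 makes all radii at least 1/2, which is the source of the uniform constant [16 ^+ m]
    in [L2_psum_pcoef]. *)
Definition radii n : R := 1 - n.+2%:R^-1.

Lemma radii_itv n : 2^-1 <= radii n < 1.
Proof.
rewrite /radii ltrBlDr ltrDl invr_gt0 ltr0n andbT.
have : n.+2%:R^-1 <= 2^-1 :> R by rewrite lef_pV2 ?posrE ?ltr0n // ler_nat.
by move: (n.+2%:R^-1) => x; lra.
Qed.

Lemma radii_homo : {homo radii : n k / (n <= k)%N >-> n <= k}.
Proof. by move=> n k nk; rewrite /radii lerD2l lerN2 lef_pV2 ?posrE ?ltr0n // ler_nat. Qed.

Lemma radii_gt (x : R) : x < 1 -> \forall n \near \oo, x < radii n.
Proof.
move=> x1; have h : (fun n => n.+1%:R^-1 : R) @ \oo --> (0:R) by exact: cvg_harmonic.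
have x0 : 0 < 1 - x by rewrite subr_gt0.
move/cvgrPdist_lt: h => /(_ _ x0); apply: filterS => n.
rewrite sub0r normrN ger0_norm // => hn; rewrite /radii.
have : n.+2%:R^-1 <= n.+1%:R^-1 :> R by rewrite lef_pV2 ?posrE ?ltr0n // ler_nat.
by move: hn; move: (n.+1%:R^-1) (n.+2%:R^-1) => s t; lra.
Qed.

Lemma bigcup_pball : \bigcup_n pball (radii n) = pball 1.
Proof.
apply/seteqP; split=> [p [n _ /= h]|p /= h].
  by apply: lt_trans h _; case/andP: (radii_itv n).
by have [n _ /(_ n (leqnn _)) hn] := radii_gt h; exists n.
Qed.

Lemma cvg_integral_pball f : mu.-integrable (pball 1) (EFin \o f) ->
  (\int[mu]_(p in pball (radii n)) (f p)%:E)%E @[n --> \oo] --> (\int[mu]_(p in pball 1) (f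
    p)%:E)%E.
Proof.
move=> fi; have mf : measurable_fun (pball 1) (EFin \o f) by apply: (measurable_int mu).
have m1 := @measurable_pball R 1.
pose F n := (EFin \o f) \_ (pball (radii n)).
have h1 n : measurable_fun (pball 1) (F n).
  apply/measurable_restrict => //; first exact: measurable_pball.
  by apply: measurable_funS mf => //; apply: subIsetl.
have h2 : {ae mu, forall p, pball 1 p -> F ^~ p @ \oo --> (EFin \o f) p}.
  apply: aeW => p hp; apply: cvg_near_cst.
  have := radii_gt hp; apply: filterS => n hn.
  by rewrite /F patchE mem_set.
have h3 : mu.-integrable (pball 1) (abse \o (EFin \o f)) by exact: integrable_abse.
have h4 : {ae mu, forall p n, pball 1 p -> (`|F n p| <= (abse \o (EFin \o f)) p)%E}.
  by apply: aeW => p n hp /=; rewrite /F patchE; case: ifPn => // _; rewrite abse0.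
have [_ _] := dominated_convergence m1 h1 mf h2 h3 h4.
rewrite (_ : (fun n => _) = (fun n => \int[mu]_(p in pball (radii n)) (f p)%:E)%E) //.
apply/funext => n; rewrite -integral_mkcondr; congr (integral _ _ _).
apply/seteqP; split=> [p []//|p /= h]; split=> //.
by apply: lt_trans h _; case/andP: (radii_itv n).
Qed.

Definition L2int u := mu.-integrable (pball 1) (EFin \o (fun p => N (u (toC p)) ^+ 2)).

Lemma measurable_sqr_normc u (D : set plane) : measurable_fun D (fun p => re (u (toC p))) ->
  measurable_fun D (fun p => im (u (toC p))) ->
  measurable_fun D (fun p => N (u (toC p)) ^+ 2).
Proof.
move=> h1 h2; under eq_fun do rewrite sqr_normcE.
by apply: measurable_funD; apply: measurable_funX.
Qed.

Lemma L2P u : L2 u <-> [/\ measurable_fun (pball 1) (fun p => re (u (toC p))),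
  measurable_fun (pball 1) (fun p => im (u (toC p))) & L2int u].
Proof.
rewrite /L2 pdisk_pball; split=> [[h1 h2 h3]|[h1 h2 /integrableP[_ h3]]]; split=> //.
- apply/integrableP; split; first by apply/measurable_EFinP; exact: measurable_sqr_normc.
  rewrite (eq_integral (fun p => (N (u (toC p)) ^+ 2)%:E)) // => p _.
  by rewrite /= ger0_norm ?sqr_ge0.
- move: h3; rewrite (eq_integral (fun p => (N (u (toC p)) ^+ 2)%:E)) // => p _.
  by rewrite /= ger0_norm ?sqr_ge0.
Qed.

Lemma normc_mul_le z w : N (z * w) <= N z ^+ 2 + N w ^+ 2.
Proof. by rewrite Normc.normcM; have := sqr_ge0 (N z - N w); have := normc_ge0 z;
  have := normc_ge0 w; nra. Qed.

Lemma L2_integrable_mulC u v : L2 u -> L2 v ->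
  mu.-integrable (pball 1) (EFin \o (fun p => re (u (toC p) * (v (toC p))^*))) /\
  mu.-integrable (pball 1) (EFin \o (fun p => im (u (toC p) * (v (toC p))^*))).
Proof.
move=> /L2P[ru iu hu] /L2P[rv iv hv]; have m1 := @measurable_pball R 1.
have hs := integrableD m1 hu hv.
have rJ z : re z^* = re z by case: z.
have iJ z : im z^* = - im z by case: z.
have h (s : C -> R) : (forall z, `|s z| <= N z) ->
    measurable_fun (pball 1) (fun p => s (u (toC p) * (v (toC p))^*)) ->
    mu.-integrable (pball 1) (EFin \o (fun p => s (u (toC p) * (v (toC p))^*))).
  move=> hs' ms; apply: (le_integrable m1 _ _ hs); first exact/measurable_EFinP.
  move=> p _ /=; rewrite lee_fin (le_trans (hs' _)) // (le_trans (normc_mul_le _ _)) //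
    normc_conj.
  exact: ler_norm.
split; apply: h; [exact: normr_Re_le| |exact: normr_Im_le|].
- under eq_fun do rewrite Re_mul rJ iJ mulrN opprK.
  by apply: measurable_funD; exact: measurable_funM.
- under eq_fun do rewrite Im_mul rJ iJ mulrN.
  by apply: measurable_funD; [apply: measurableT_comp => //|]; exact: measurable_funM.
Qed.

Lemma L2_lin u v (a b : C) : L2 u -> L2 v -> L2 (fun z => a * u z + b * v z).
Proof.
move=> /L2P[ru iu hu] /L2P[rv iv hv]; have m1 := @measurable_pball R 1.
have cM (s : R) (f : plane -> R) : measurable_fun (pball 1) f -> measurable_fun (pball 1) (fun
  p => s * f p).
  by move=> hf; apply: measurable_funM.
have mre : measurable_fun (pball 1) (fun p => re (a * u (toC p) + b * v (toC p))).
  under eq_fun do rewrite Re_add !Re_mul.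
  by apply: measurable_funD; apply: measurable_funB; exact: cM.
have mim : measurable_fun (pball 1) (fun p => im (a * u (toC p) + b * v (toC p))).
  under eq_fun do rewrite Im_add !Im_mul.
  by apply: measurable_funD; apply: measurable_funD; exact: cM.
apply/L2P; split=> //.
have := integrableD m1 (integrableZl m1 (2 * N a ^+ 2) hu) (integrableZl m1 (2 * N b ^+ 2) hv).
apply: le_integrable => //.
  by apply/measurable_EFinP; exact: (measurable_sqr_normc (u := fun z => a * u z + b * v z)).
move=> p _ /=; rewrite lee_fin !ger0_norm ?sqr_ge0 //; last first.
  by rewrite addr_ge0 // mulr_ge0 ?sqr_ge0 // mulr_ge0 ?sqr_ge0.
have := le_normcD (a * u (toC p)) (b * v (toC p)); rewrite !Normc.normcM.
have := normc_ge0 (a * u (toC p) + b * v (toC p)).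
move: (N _) (N a) (N (u _)) (N b) (N (v _)) => s x y x' y' s0 h.
have : s ^+ 2 <= (x * y + x' * y') ^+ 2 by rewrite lerXn2r ?nnegrE // (le_trans s0).
by have := sqr_ge0 (x * y - x' * y'); nra.
Qed.

Lemma L2_bounded_mul u v (M : R) :
  measurable_fun (pball 1) (fun p => re (u (toC p))) ->
  measurable_fun (pball 1) (fun p => im (u (toC p))) ->
  (forall z, disk z -> N (u z) <= M) -> L2 v -> L2 (fun z => u z * v z).
Proof.
move=> ru iu hM /L2P[rv iv hv]; have m1 := @measurable_pball R 1.
have mre : measurable_fun (pball 1) (fun p => re (u (toC p) * v (toC p))).
  by under eq_fun do rewrite Re_mul; apply: measurable_funB; exact: measurable_funM.
have mim : measurable_fun (pball 1) (fun p => im (u (toC p) * v (toC p))).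
  by under eq_fun do rewrite Im_mul; apply: measurable_funD; exact: measurable_funM.
apply/L2P; split=> //.
have := integrableZl m1 (M ^+ 2) hv; apply: le_integrable => //.
  by apply/measurable_EFinP; exact: (measurable_sqr_normc (u := fun z => u z * v z)).
move=> p /diskP hp /=; rewrite lee_fin !ger0_norm ?sqr_ge0 //; last first.
  by apply: mulr_ge0; exact: sqr_ge0.
rewrite Normc.normcM exprMn ler_wpM2r ?sqr_ge0 // lerXn2r ?nnegrE ?normc_ge0 ?hM //.
by rewrite (le_trans (normc_ge0 _) (hM _ hp)).
Qed.

Lemma L2_eq u v : (forall z, disk z -> u z = v z) -> L2 u -> L2 v.
Proof.
move=> h [h1 h2 h3]; have e p : @pdisk R p -> u (toC p) = v (toC p) by move=> hp; apply: h.
split.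
- by apply: eq_measurable_fun h1 => p /[!inE] /e ->.
- by apply: eq_measurable_fun h2 => p /[!inE] /e ->.
- rewrite (eq_integral (fun p => (N (u (toC p)) ^+ 2)%:E)) // => p /[!inE] hp.
  by rewrite e.
Qed.

End AreaMeasure.

(** * Projection of conj(z)^m g *)

Section Projection.
Variable R : realType.
Local Notation C := R[i].
Local Notation N := (@Normc.normc R).
Local Notation re := (@complex.Re R).
Local Notation im := (@complex.Im R).
Local Notation plane := (measurableTypeR R * measurableTypeR R)%type.
Local Notation leb := (@lebesgue_measure R).
Local Notation leb2 := ((leb \x leb)%E : {measure set plane -> \bar R}).
Local Notation mu := (@dA R).
Implicit Types (z w : C) (F G k : C -> C).

Lemma Re_conj z : re z^* = re z. Proof. by case: z. Qed.
Lemma Im_conj z : im z^* = - im z. Proof. by case: z. Qed.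

Definition ccont F z := cont (fun w => re (F w)) z /\ cont (fun w => im (F w)) z.

Lemma ccont_cst (l : C) z : ccont (fun=> l) z.
Proof. by split; exact: cvg_cst. Qed.
Lemma ccontD F G z : ccont F z -> ccont G z -> ccont (fun w => F w + G w) z.
Proof.
case=> a b [c d]; split.
- by under eq_fun do rewrite Re_add; exact: (contD a c).
- by under eq_fun do rewrite Im_add; exact: (contD b d).
Qed.
Lemma ccontM F G z : ccont F z -> ccont G z -> ccont (fun w => F w * G w) z.
Proof.
case=> a b [c d]; split.
- by under eq_fun do rewrite Re_mul; exact: (contB (contM a c) (contM b d)).
- by under eq_fun do rewrite Im_mul; exact: (contD (contM a d) (contM b c)).
Qed.
Lemma ccontJ F z : ccont F z -> ccont (fun w => (F w)^*) z.
Proof.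
case=> a b; split.
- by under eq_fun do rewrite Re_conj.
- by under eq_fun do rewrite Im_conj; exact: (contN b).
Qed.
Lemma ccont_expr n z : ccont (fun w => w ^+ n) z.
Proof.
elim: n => [|n IH]; first exact: ccont_cst.
under eq_fun do rewrite exprS; apply: ccontM => //.
by split; apply: contP => e e0; exists e => // w; apply: le_lt_trans;
  rewrite -?Re_opp -?Re_add -?Im_opp -?Im_add ?normr_Re_le ?normr_Im_le.
Qed.
Lemma cont_sqr_normc F z : ccont F z -> cont (fun w => N (F w) ^+ 2) z.
Proof.
case=> a b; under eq_fun do rewrite sqr_normcE.
exact: (contD (contM a a) (contM b b)).
Qed.

Lemma analytic_ccont F : analytic_on disk F -> forall z, disk z -> ccont F z.
Proof.
move=> hF z /hF/analytic_qdiff[hq _].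
by split; [exact: qdiff_contRe hq|exact: qdiff_contIm hq].
Qed.

(** On each smaller disk the integral of [A] is [q n] times that of [B]. Both functions are
    integrable on the full disk, so both sides converge by dominated convergence. *)
Lemma integral_eq_lim (A B : plane -> R) (q : nat -> R) :
  mu.-integrable (pball 1) (EFin \o A) -> mu.-integrable (pball 1) (EFin \o B) ->
  q @ \oo --> (1 : R) ->
  (forall n, (\int[mu]_(p in pball (radii R n)) (A p - q n * B p)%:E = 0)%E) ->
  (\int[mu]_(p in pball 1) A p = \int[mu]_(p in pball 1) B p)%R.
Proof.
move=> hA hB hq h.
have sub n : pball (radii R n) `<=` pball 1.
  by move=> p /= hp; apply: lt_trans hp _; case/andP: (radii_itv R n).
have iA n := integrableS (measurable_pball 1) (measurable_pball (radii R n)) (sub n) hA.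
have iB n := integrableS (measurable_pball 1) (measurable_pball (radii R n)) (sub n) hB.
have cvA (f : plane -> R) : mu.-integrable (pball 1) (EFin \o f) ->
    (\int[mu]_(p in pball (radii R n)) f p)%R @[n --> \oo] --> (\int[mu]_(p in pball 1) f p)%R.
  move=> hf; apply: fine_cvg; rewrite fineK; first exact: cvg_integral_pball.
  by apply: integrable_fin_num hf; exact: measurable_pball.
have hlim : (\int[mu]_(p in pball (radii R n)) A p)%R @[n --> \oo] --> 1 * (\int[mu]_(p in
  pball 1) B p)%R.
  rewrite (_ : (fun n => _) = (fun n => q n * (\int[mu]_(p in pball (radii R n)) B p)%R)).
    by apply: cvgM => //; exact: cvA.
  apply/funext => n; apply/eqP; rewrite -subr_eq0 -RintegralZl //; last exact: measurable_pball.
  rewrite -RintegralB //; [|exact: measurable_pball|].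
    by rewrite /Rintegral h.
  by have := integrableZl (measurable_pball (radii R n)) (q n) (iB n).
by rewrite (cvg_unique _ (cvA A hA) hlim) // mul1r.
Qed.

Variables (m : nat) (d : nat -> C) (g : C -> C).
Hypothesis g_bergman : bergman g.
Hypothesis g_sum : forall z, disk z -> power_sum d z (g z).

Let hd : radius_ge d 1 := disk_radius g_sum.
Let h0 := psum (pcoef m d).
Let h0_an : analytic_on disk h0.
Proof. exact: psum_analytic (radius_ge_pcoef m hd). Qed.

(** The integrand of [dbar_identity] for [q = r ^+ (2 * m)]. At [q = 1] it is the conjugate of the
    integrand of the inner product of conj(z)^m g - h0 with [k]. *)
Definition defect (q : R) k z := k z * (z ^+ m * (g z)^* - q%:C * (h0 z)^*).

Let defect_ccont q k z : analytic_on disk k -> disk z -> ccont (defect q k) z.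
Proof.
move=> hk hz; have [ga _] := g_bergman.
rewrite (_ : defect q k = (fun w => k w * (w ^+ m * (g w)^* + - q%:C * (h0 w)^*))).
  exact: (ccontM (analytic_ccont hk hz) (ccontD (ccontM (ccont_expr m z)
    (ccontJ (analytic_ccont ga hz))) (ccontM (ccont_cst (- q%:C) z)
    (ccontJ (analytic_ccont h0_an hz))))).
by apply/funext => w; rewrite mulNr.
Qed.

Lemma defect_integral0 k (r : R) : analytic_on disk k -> 0 <= r < 1 ->
  (\int[mu]_(p in pball r) (re (defect (r ^+ (2 * m)) k (toC p)))%:E = 0)%E /\
  (\int[mu]_(p in pball r) (im (defect (r ^+ (2 * m)) k (toC p)))%:E = 0)%E.
Proof.
move=> hk /[dup] r01 /andP[r0 r1].
have pd (p : plane) : pball r p -> disk (toC p) by move=> h; apply/diskP; exact: lt_trans h r1.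
have [hre him] := dbar_identity m hd hk r01.
split; apply: dA_integral0; try exact: measurable_pball.
- apply: (@integrable_pball R leb2 (fun w => re (defect (r ^+ (2 * m)) k w)) r (leb2_pball1 R)
  r1) => z hz.
  by have [] := defect_ccont (r ^+ (2 * m)) hk hz.
- rewrite -[RHS]hre; apply: eq_integral => p /[!inE] /pd hp.
  by rewrite /defect (disk_psum g_sum).
- apply: (@integrable_pball R leb2 (fun w => im (defect (r ^+ (2 * m)) k w)) r (leb2_pball1 R)
  r1) => z hz.
  by have [] := defect_ccont (r ^+ (2 * m)) hk hz.
- rewrite -[RHS]him; apply: eq_integral => p /[!inE] /pd hp.
  by rewrite /defect (disk_psum g_sum).
Qed.

(** With Y = z^m conj(g), completing the square gives |Y|^2 - 2 q re ([defect q h0 z]) - q^2 |h0|^2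
    = |Y - q conj(h0)|^2 >= 0, and |Y| <= |g| on the disk. *)
Lemma sqr_normc_defect_le z (q : R) : disk z -> 0 <= q ->
  q ^+ 2 * N (h0 z) ^+ 2 <= N (g z) ^+ 2 - 2 * q * re (defect q h0 z).
Proof.
move=> /diskP hz q0; rewrite /defect.
pose Y := z ^+ m * (g z)^*.
have hY : N Y ^+ 2 <= N (g z) ^+ 2.
  rewrite lerXn2r ?nnegrE ?normc_ge0 // Normc.normcM normcX normc_conj ler_piMl ?normc_ge0 //.
  by rewrite exprn_ile1 ?normc_ge0 // ltW.
apply: (@le_trans _ _ (N Y ^+ 2 - 2 * q * re (h0 z * (Y - q%:C * (h0 z)^*)))); last first.
  by rewrite lerD2r.
move: Y {hY} (h0 z) => [y1 y2] [a b]; rewrite !sqr_normcE Re_mul !Re_add !Im_add Re_opp Im_opp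
  !Re_mul !Im_mul Re_conj Im_conj /=.
have := sqr_ge0 (y1 - q * a); have := sqr_ge0 (y2 + q * b).
nra.
Qed.

(** A Bessel-type bound: integrating [sqr_normc_defect_le] over |z| < r removes the defect term, so
    q^2 times the integral of |h0|^2 is at most that of |g|^2. With q^2 = r^(4m) bounded below,
    monotone convergence as r tends to 1 applies. *)
Lemma L2_psum_pcoef : L2 h0.
Proof.
have [ga gL2] := g_bergman; have /L2P[rg ig hg] := gL2.
have m1 := @measurable_pball R 1.
have ch : forall z, disk z -> cont (fun w => N (h0 w) ^+ 2) z.
  by move=> z hz; apply: cont_sqr_normc; exact: analytic_ccont.
have cg : forall z, disk z -> cont (fun w => N (g w) ^+ 2) z.
  by move=> z hz; apply: cont_sqr_normc; exact: analytic_ccont.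
split; rewrite pdisk_pball.
- by apply: (@measurable_fun_pball1 _ (fun w => re (h0 w))) => z hz;
  have [] := analytic_ccont h0_an hz.
- by apply: (@measurable_fun_pball1 _ (fun w => im (h0 w))) => z hz;
  have [] := analytic_ccont h0_an hz.
pose I := (\int[mu]_(p in pball 1) (N (g (toC p)) ^+ 2)%:E)%E.
have mN2 u : (forall z, disk z -> cont u z) ->
    measurable_fun (pball 1) (fun p => (u (toC p))%:E).
  by move=> hu; apply/measurable_EFinP; exact: measurable_fun_pball1.
have sub n : pball (radii R n) `<=` pball 1.
  by move=> p /= hp; apply: lt_trans hp _; case/andP: (radii_itv R n).
have bnd n : (\int[mu]_(p in pball (radii R n)) (N (h0 (toC p)) ^+ 2)%:E <= (16 ^+ m)%:E * I)%E.
  have /andP[rn2 rn1] := radii_itv R n; set r := radii R n in rn2 rn1 *.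
  have r0 : 0 <= r by apply: le_trans rn2; rewrite invr_ge0.
  pose q := r ^+ (2 * m).
  have q0 : 0 <= q by rewrite exprn_ge0.
  have [X0 _] := defect_integral0 h0_an (introT andP (conj r0 rn1)).
  have pd (p : plane) : pball r p -> disk (toC p) by move=> h; apply/diskP; exact: lt_trans h rn1.
  have mr := @measurable_pball R r.
  have ix : forall u, (forall z, disk z -> cont u z) ->
      mu.-integrable (pball r) (EFin \o (fun p => u (toC p))).
    by move=> u hu; exact: (@integrable_pball R mu u r (dA_pball1 R) rn1 hu).
  have iX : mu.-integrable (pball r) (EFin \o (fun p => re (defect q h0 (toC p)))).
    apply: (ix (fun w => re (defect q h0 w))) => z hz.
    by have [] := defect_ccont q h0_an hz.
  have iKg := integrableZl mr (16 ^+ m) (ix _ cg).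
  have iKX := integrableZl mr (16 ^+ m * (2 * q)) iX.
  apply: (@le_trans _ _ (\int[mu]_(p in pball r) ((16 ^+ m)%:E * (N (g (toC p)) ^+ 2)%:E
      - (16 ^+ m * (2 * q))%:E * (re (defect q h0 (toC p)))%:E))%E).
    apply: le_integral => //; [exact: (ix _ ch)|exact: (integrableB mr iKg iKX)|].
    move=> p /[!inE] /pd hp; rewrite lee_fin.
    have := sqr_normc_defect_le hp q0.
    (* Since r >= 1/2, one has 16 r^4 >= 1; the [m]-th power of this is the claim, because q^2 =
       r^(4m). *)
    have Kq : 1 <= 16 ^+ m * q ^+ 2.
      rewrite /q exprM exprAC -exprMn exprn_ege1 // -exprM.
      have : (2^-1 : R) ^+ 4 <= r ^+ 4 by rewrite lerXn2r ?nnegrE ?invr_ge0.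
      have -> : (2^-1 : R) ^+ 4 = 16^-1 by field.
      move=> h; rewrite -[leLHS](divff (_ : 16 != 0)) ?pnatr_eq0 //.
      by rewrite ler_wpM2l.
    move: (N (h0 _) ^+ 2) (sqr_ge0 (N (h0 (toC p)))) => H H0.
    move: (16 ^+ m) Kq (re _) (N (g _) ^+ 2) => K Kq X G hX.
    have K0 : 0 <= K by have := sqr_ge0 q; nra.
    apply: (@le_trans _ _ (K * q ^+ 2 * H)); first by rewrite ler_peMl.
    rewrite -mulrA (_ : _ - _ = K * (G - 2 * q * X)); last by ring.
    by rewrite ler_wpM2l.
  rewrite integralB // !integralZl //; last exact: (ix _ cg).
  rewrite X0 mule0 sube0.
  apply: lee_wpmul2l; first by rewrite lee_fin exprn_ge0.
  by apply: ge0_subset_integral => //; [exact: (mN2 _ cg)|move=> p _;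
    rewrite lee_fin sqr_ge0|exact: sub].
have cv : (\int[mu]_(p in pball (radii R n)) (N (h0 (toC p)) ^+ 2)%:E)%E @[n --> \oo] -->
    (\int[mu]_(p in \bigcup_n pball (radii R n)) (N (h0 (toC p)) ^+ 2)%:E)%E.
  apply: ge0_nondecreasing_set_cvg_integral.
  - move=> n k nk; apply/subsetPset => p /= hp; apply: lt_le_trans hp _; exact: radii_homo.
  - by move=> n; exact: measurable_pball.
  - by move=> n; apply: measurable_funS (mN2 _ ch).
  - by move=> n p _; rewrite lee_fin sqr_ge0.
have Ioo : ((16 ^+ m)%:E * I < +oo)%E.
  apply: lte_mul_pinfty; rewrite ?lee_fin ?exprn_ge0 //.
  by case: gL2 => _ _; rewrite pdisk_pball.
rewrite -bigcup_pball -(cvg_lim _ cv) //; apply: le_lt_trans Ioo.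
apply: lime_le; first by apply/cvg_ex; eexists; exact: cv.
exact: nearW.
Qed.

Let u0 := fun z : C => (z^*) ^+ m * g z.

Lemma L2_conjX_mul : L2 u0.
Proof.
apply: (L2_bounded_mul (M := 1)); last by case: g_bergman.
- apply: (@measurable_fun_pball1 _ (fun w => re ((w^*) ^+ m))) => z _.
  rewrite (_ : (fun w => _) = (fun w => re ((w ^+ m)^*))); last first.
    by apply/funext => w; rewrite rmorphXn.
  by have [] := ccontJ (ccont_expr m z).
- apply: (@measurable_fun_pball1 _ (fun w => im ((w^*) ^+ m))) => z _.
  rewrite (_ : (fun w => _) = (fun w => im ((w ^+ m)^*))); last first.
    by apply/funext => w; rewrite rmorphXn.
  by have [] := ccontJ (ccont_expr m z).
- by move=> z /diskP hz; rewrite normcX normc_conj exprn_ile1 ?normc_ge0 // ltW.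
Qed.

Lemma orthogonal_psum_pcoef k : bergman k -> inner (fun z => u0 z - h0 z) k = 0.
Proof.
move=> [ka kL2].
have [iA iA'] := L2_integrable_mulC kL2 L2_conjX_mul.
have [iB iB'] := L2_integrable_mulC kL2 L2_psum_pcoef.
pose q n := radii R n ^+ (2 * m).
have hq : q @ \oo --> (1 : R).
  have h : radii R n @[n --> \oo] --> (1 : R).
    apply/cvgrPdist_lt => e e0; have /radii_gt : 1 - e < 1 by rewrite ltrBlDr ltrDl.
    apply: filterS => n hn; have /andP[_ r1] := radii_itv R n.
    by rewrite gtr0_norm ?subr_gt0 // ltrBlDr -ltrBlDl.
  rewrite (_ : 1 = 1 ^+ (2 * m)); last by rewrite expr1n.
  have h' (j : nat) : radii R n ^+ j @[n --> \oo] --> (1 : R) ^+ j.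
    elim: j => [|j IH]; first exact: cvg_cst.
    by under eq_fun do rewrite exprS; rewrite exprS; exact: cvgM.
  exact: h'.
(* Stated for any real-linear [s], to be used with both [re] and [im]. *)
have E (s : C -> R) n p : (forall z w, s (z - w) = s z - s w) ->
    (forall (x : R) z, s (x%:C * z) = x * s z) ->
    s (k (toC p) * (u0 (toC p))^*) - q n * s (k (toC p) * (h0 (toC p))^*) =
    s (defect (q n) k (toC p)).
  move=> sB sZ; rewrite /defect -sZ -sB; congr (s _).
  have -> : (u0 (toC p))^* = toC p ^+ m * (g (toC p))^* by rewrite /u0 rmorphM rmorphXn /= conjCK.
  by ring.
have K n := defect_integral0 ka (r := radii R n) _.
have rn01 n : 0 <= radii R n < 1.
  by have /andP[h ->] := radii_itv R n; rewrite andbT (le_trans _ h) // invr_ge0.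
have eA : (\int[mu]_(p in pball 1) re (k (toC p) * (u0 (toC p))^*) =
   \int[mu]_(p in pball 1) re (k (toC p) * (h0 (toC p))^*))%R.
  apply: (integral_eq_lim (q := q)) => // n.
  have [h _] := K rn01 n; rewrite -[RHS]h; apply: eq_integral => p _.
  rewrite (E re) // => [z w|x z]; first by rewrite Re_add Re_opp.
  by rewrite Re_mul /= mul0r subr0.
have eB : (\int[mu]_(p in pball 1) im (k (toC p) * (u0 (toC p))^*) =
   \int[mu]_(p in pball 1) im (k (toC p) * (h0 (toC p))^*))%R.
  apply: (integral_eq_lim (q := q)) => // n.
  have [_ h] := K rn01 n; rewrite -[RHS]h; apply: eq_integral => p _.
  rewrite (E im) // => [z w|x z]; first by rewrite Im_add Im_opp.
  by rewrite Im_mul /= mul0r addr0.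
have m1 := @measurable_pball R 1.
rewrite /inner /cintegral pdisk_pball; apply/eqP; rewrite eq_complex /=; apply/andP; split;
  apply/eqP.
(* [inner] conjugates [k], while [eA] and [eB] conjugate the other factor. Conjugation keeps the
   real part and negates the imaginary part, so the two integrals are subtracted in the opposite
   order in the second case. *)
- rewrite -[RHS](subrr (\int[mu]_(p in pball 1) re (k (toC p) * (u0 (toC p))^*))%R) {2}eA.
  rewrite -RintegralB //; apply: eq_Rintegral => p _.
  rewrite -Re_opp -Re_add -[LHS]Re_conj; congr re.
  by rewrite rmorphM /= conjCK rmorphB /=; ring.
- rewrite -[RHS](subrr (\int[mu]_(p in pball 1) im (k (toC p) * (h0 (toC p))^*))%R) -{2}eB.
  rewrite -RintegralB //; apply: eq_Rintegral => p _.
  rewrite -Im_opp -Im_add -[LHS]opprK -Im_conj -Im_opp; congr im.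
  by rewrite rmorphM /= conjCK rmorphB /=; ring.
Qed.

End Projection.

(** * The Toeplitz operator *)

Section Toeplitz.
Variable R : realType.
Local Notation C := R[i].
Local Notation N := (@Normc.normc R).
Local Notation re := (@complex.Re R).
Local Notation im := (@complex.Im R).
Local Notation plane := (measurableTypeR R * measurableTypeR R)%type.
Local Notation leb := (@lebesgue_measure R).
Local Notation leb2 := ((leb \x leb)%E : {measure set plane -> \bar R}).
Local Notation mu := (@dA R).
Implicit Types (z w : C) (f g k u v e : C -> C).

Lemma innerB u v k : L2 u -> L2 v -> L2 k ->
  inner (fun z => u z - v z) k = inner u k - inner v k.
Proof.
move=> hu hv hk; have [iu iu'] := L2_integrable_mulC hu hk.
have [iv iv'] := L2_integrable_mulC hv hk.
have m1 := @measurable_pball R 1.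
rewrite /inner /cintegral pdisk_pball; apply/eqP; rewrite eq_complex /=; apply/andP; split;
  apply/eqP.
- rewrite -RintegralB //; apply: eq_Rintegral => p _.
  by rewrite -Re_opp -Re_add -mulNr -mulrDl.
- rewrite -RintegralB //; apply: eq_Rintegral => p _.
  by rewrite -Im_opp -Im_add -mulNr -mulrDl.
Qed.

(** Continuity turns a vanishing L^2 norm into pointwise vanishing: if e(z) is nonzero, |e|^2
    exceeds half of |e(z)|^2 on a neighbourhood of positive area. *)
Lemma inner_self_eq0 e : bergman e -> inner e e = 0 -> forall z, disk z -> e z = 0.
Proof.
move=> [ea eL2] e0 z hz; have /L2P[_ _ ei] := eL2.
have m1 := @measurable_pball R 1.
have I0 : (\int[mu]_(p in pball 1) (N (e (toC p)) ^+ 2)%:E = 0)%E.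
  move: e0; rewrite /inner /cintegral pdisk_pball => -[h _].
  rewrite -(fineK (integrable_fin_num m1 ei)); congr (_%:E).
  rewrite -[RHS]h; apply: eq_Rintegral => p _.
  by rewrite mul_conj_normc.
apply/eqP; rewrite -normc_eq0; apply/negPn/negP => Nz.
pose c := N (e z) ^+ 2; have c0 : 0 < c by rewrite exprn_gt0 // lt_def Nz normc_ge0.
have c20 : 0 < c / 2 by rewrite divr_gt0.
have hc : cont (fun w => N (e w) ^+ 2) z by apply: cont_sqr_normc; exact: analytic_ccont.
have [d d0 hd] : exists2 d : R, 0 < d & ball (re z) d `*` ball (im z) d `<=`
    [set p : R * R | N (p.1 +i* p.2) < 1 /\ c / 2 < N (e (p.1 +i* p.2)) ^+ 2].
  have : nbhs (re z, im z) [set p : R * R | N (p.1 +i* p.2) < 1 /\ c / 2 < N (e (p.1 +i* p.2))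
    ^+ 2].
    apply: filterI.
      apply: open_nbhs_nbhs; split; first exact: open_normc_lt.
      by rewrite /=; move/diskP: hz; case: (z).
    move: hc; rewrite /cont /= => /cvgrPdist_lt/(_ _ c20); apply: filterS => p /=.
    rewrite (_ : re z +i* im z = z) -/c; last by case: (z).
    by rewrite ltr_distl => /andP[_]; move: (N _ ^+ 2) => y; lra.
  by case/nbhs_ballP => d /= d0 hd; exists d => // p [h1 h2]; apply: hd; split.
(* A square is chosen because its product measure is the product of two interval lengths. *)
pose B : set plane := ball (re z) d `*` ball (im z) d.
have mB : measurable B by apply: measurableX; apply: open_measurable; exact: ball_open.
have B1 : B `<=` pball 1 by move=> p /hd[].
have muB : (0 < mu B)%E.
  rewrite /dA /mscale /=; apply: mule_gt0; first by rewrite lte_fin invr_gt0 pi_gt0.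
  have -> : (leb2 B = leb (ball (re z) d) * leb (ball (im z) d))%E.
    by apply: product_measure1E; apply: open_measurable; exact: ball_open.
  by apply: mule_gt0; rewrite lebesgue_measure_ball ?ltW // lte_fin mulrn_wgt0.
have mN : measurable_fun (pball 1) (fun p => (N (e (toC p)) ^+ 2)%:E) by apply: (measurable_int
  mu).
have : ((c / 2)%:E * mu B <= 0)%E.
  rewrite -I0; apply: (@le_trans _ _ (\int[mu]_(p in B) (N (e (toC p)) ^+ 2)%:E)%E); last first.
    by apply: ge0_subset_integral => // p _; rewrite lee_fin sqr_ge0.
  rewrite -integral_cst //; apply: ge0_le_integral => //.
  - by move=> p _; rewrite lee_fin ?ltW ?sqr_ge0.
  - exact: (measurable_funS m1 B1 mN).
  - by move=> p hp; have [_ h] := hd p hp; rewrite lee_fin ltW.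
by apply/negP; rewrite -ltNge; apply: mule_gt0.
Qed.

Variables (m : nat) (a d : nat -> C) (f g : C -> C).
Hypothesis f_Hinfty : Hinfty f.
Hypothesis f_sum : forall z, disk z -> power_sum a z (f z).
Hypothesis g_bergman : bergman g.
Hypothesis g_sum : forall z, disk z -> power_sum d z (g z).

Let h0 := psum (pcoef m d).

Lemma mul_power_sum z : disk z -> power_sum (cauchy_coef a d) z (f z * g z).
Proof.
move=> hz; rewrite (disk_psum f_sum hz) (disk_psum g_sum hz).
by apply: (power_sum_mul (disk_radius f_sum) (disk_radius g_sum)); exact/diskP.
Qed.

(** The candidate [h] shows that the set in [bergman_proj] is inhabited, so [xget] returns a genuine
    member [P] and not its default. Both satisfy the orthogonality condition, hence P - h is a
    Bergman function orthogonal to itself and vanishes on the disk. *)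
Lemma toeplitzE z : disk z ->
  toeplitz (fun w => (w^*) ^+ m + f w) g z = f z * g z + h0 z.
Proof.
move=> hz; have [fa [M hM]] := f_Hinfty; have [ga gL2] := g_bergman.
have h0a : analytic_on disk h0 by apply: psum_analytic (radius_ge_pcoef m (disk_radius g_sum)).
have h0L : L2 h0 := L2_psum_pcoef m g_bergman g_sum.
have fga : analytic_on disk (fun w => f w * g w).
  apply: analytic_on_eq (psum_analytic (disk_radius mul_power_sum)) => w hw.
  by rewrite (psum_eq (mul_power_sum hw)).
have fgL : L2 (fun w => f w * g w).
  apply: (L2_bounded_mul (M := M)) gL2.
  - by apply: (@measurable_fun_pball1 _ (fun w => re (f w))) => w hw;
    have [] := analytic_ccont fa hw.
  - by apply: (@measurable_fun_pball1 _ (fun w => im (f w))) => w hw;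
    have [] := analytic_ccont fa hw.
  - by move=> w /hM; rewrite norm_normcE lecR.
pose u w := ((w^*) ^+ m + f w) * g w.
pose h w := 1 * (f w * g w) + 1 * h0 w.
have hL : L2 h by apply: L2_lin.
have ha : analytic_on disk h by apply: analytic_lin.
have uL : L2 u.
  apply: L2_eq (L2_lin 1 1 (L2_conjX_mul m g_bergman) fgL) => w _.
  by rewrite /u !mul1r mulrDl.
have horth k : bergman k -> inner (fun w => u w - h w) k = 0.
  move=> hk; rewrite -(orthogonal_psum_pcoef m g_bergman g_sum hk).
  rewrite /inner; congr cintegral; apply/funext => w; congr (_ * _).
  by rewrite /u /h !mul1r mulrDl opprD addrA addrK.
have [[pa pL] porth] : [set h' | bergman h' /\ forall k, bergman k -> inner (fun w => u w - h'
  w) k = 0]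
    (toeplitz (fun w => (w^*) ^+ m + f w) g).
  rewrite /toeplitz /bergman_proj; case: xgetP => [y _ //|/(_ h)].
  by case.
move: (toeplitz _ _) pa pL porth => P pa pL porth.
(* The difference is written as a linear combination to match [L2_lin] and [analytic_lin]. *)
pose e w := 1 * P w + (-1) * h w.
have eL : L2 e by apply: L2_lin.
have ea : analytic_on disk e by apply: analytic_lin.
have ee : inner e e = 0.
  have h1 := horth e (conj ea eL); have h2 := porth e (conj ea eL).
  rewrite innerB // in h1; rewrite innerB // in h2.
  have -> : inner e e = inner (fun w => P w - h w) e.
    by rewrite /inner; congr cintegral; apply/funext => w; rewrite /e mul1r mulN1r.
  rewrite innerB //; move/eqP: h1; rewrite subr_eq0 => /eqP <-.
  by rewrite -opprB h2 oppr0.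
have := inner_self_eq0 (conj ea eL) ee hz.
by rewrite /e /h !mul1r mulN1r => /eqP; rewrite subr_eq0 => /eqP.
Qed.

End Toeplitz.

(** * Coefficients *)

Section Coefficients.
Variable R : realType.
Local Notation C := R[i].
Local Notation N := (@Normc.normc R).
Implicit Types (z w l : C) (c : nat -> C) (F G : C -> C).

(** The operator z d/dz acts diagonally on coefficients, which removes the index shift of the
    derivative from the differential equations. *)
Lemma psum_euler c r z : radius_ge c r -> N z < r ->
  z * psum (dcoef c) z = psum (fun n => n%:R * c n) z.
Proof.
move=> hc hz; rewrite (psum_split 1 (radius_ge_natM hc) hz) big_ord1 !mul0r add0r expr1.
by congr (_ * _); apply: eq_psum => n; rewrite addn1.
Qed.

Lemma qdiff_eq_at F G z l l' (r : R) : 0 < r -> qdiff F z l -> qdiff G z l' ->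
  (forall w, 0 < N (w - z) < r -> F w = G w) -> F z = G z.
Proof.
move=> r0 /qdiff_cont hF /qdiff_cont hG FG.
apply/eqP; rewrite -subr_eq0 -normc_eq0 eq_le normc_ge0 andbT; apply/ler_addgt0Pr => e e0.
rewrite add0r; have e20 : 0 < e / 2 by rewrite divr_gt0.
have [d1 d10 h1] := hF _ e20; have [d2 d20 h2] := hG _ e20.
pose x : R := Num.min r (Num.min d1 d2) / 2.
have M0 : 0 < Num.min r (Num.min d1 d2) by rewrite !lt_min r0 d10.
have x0 : 0 < x by rewrite divr_gt0.
have : x < Num.min r (Num.min d1 d2) by rewrite /x; lra.
rewrite !lt_min => /and3P[xr x1 x2].
pose w := z + x%:C.
have wz : N (w - z) = x by rewrite /w addrC addKr normc_real gtr0_norm.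
have := h1 w; rewrite wz => /(_ x1) k1; have := h2 w; rewrite wz => /(_ x2) k2.
have E : F w = G w by apply: FG; rewrite wz x0.
have -> : F z - G z = (G w - G z) - (F w - F z) by rewrite E; ring.
by rewrite (le_trans (le_normcB _ _)) // [e]splitr lerD // ltW.
Qed.

Variables (m : nat) (a d : nat -> C) (f g g0 g1 g2 : C -> C).
Hypothesis f_sum : forall z, disk z -> power_sum a z (f z).
Hypothesis g_sum : forall z, disk z -> power_sum d z (g z).
Hypothesis g0E : forall z, disk z -> g0 z = \sum_(k < m) d k * z ^+ k.
Hypothesis g1E : forall z, disk z -> g z = g0 z + g1 z.
Hypothesis g2_analytic : analytic_on disk g2.
Hypothesis g2E : forall z, disk z -> g1 z = z ^+ m * g2 z.

Let b := cauchy_coef a d.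
Let fg_sum z : disk z -> power_sum b z (f z * g z).
Proof. exact: mul_power_sum. Qed.

Let hd : radius_ge d 1 := disk_radius g_sum.
Let hb : radius_ge b 1 := disk_radius fg_sum.
Let dm n := d (n + m)%N.
Let hdm : radius_ge dm 1 := radius_ge_shift m hd.

(** Cancelling z^m identifies [g2] with the shifted series only off the origin; the value at 0 is
    recovered from the continuity of both functions. *)
Lemma g2_sum z : disk z -> power_sum dm z (g2 z).
Proof.
move=> /[dup] hz /diskP hz1.
suff -> : g2 z = psum dm z by exact: psumP hdm hz1.
have off0 w : disk w -> w != 0 -> g2 w = psum dm w.
  move=> hw w0; apply: (mulfI (expf_neq0 m w0)); rewrite -g2E //.
  apply: (addrI (g0 w)); rewrite -g1E // g0E // (disk_psum g_sum) //.
  by apply: (psum_split m hd); exact/diskP.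
have [->|z0] := eqVneq z 0; last exact: off0.
have d0 : disk (0 : C) by apply/diskP; rewrite normc_0.
have [q1 _] := analytic_qdiff (g2_analytic d0).
have q2 : qdiff (psum dm) 0 (psum (dcoef dm) 0) by apply: (qdiff_psum hdm); exact/diskP.
apply: (qdiff_eq_at ltr01 q1 q2) => w; rewrite subr0 => /andP[w0 w1].
by apply: off0; [exact/diskP|rewrite -normc_eq0 gt_eqF].
Qed.

(** The coefficient of z^k in the left side of the third equation: z g2' + g2 multiplies d_{m+k} by
    k + 1, and (m+1) fg + z (fg)' multiplies that of fg by m + 1 + k. All four conditions are
    compared with the vanishing of this sequence. *)
Definition ode_coef k : C := k.+1%:R * d (m + k)%N + (m%:R + 1 + k%:R) * b k.

Lemma radius_ge_ode_coef : radius_ge ode_coef 1.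
Proof.
have h1 := radius_ge_natM hdm; have h2 := radius_ge_natM hb.
have h3 : radius_ge (fun n => (m%:R + 1) * b n) 1.
  by apply: (radius_ge_le (K := N (m%:R + 1))) hb => n; rewrite Normc.normcM.
have := radius_ge_D (radius_ge_D h1 hdm) (radius_ge_D h2 h3).
rewrite (_ : (fun n => _) = ode_coef) //; apply/funext => n.
by rewrite /ode_coef /dm addnC -natr1; ring.
Qed.

Lemma ode_dm z : disk z -> z * cderiv g2 z + g2 z = psum (fun k => k.+1%:R * dm k) z.
Proof.
move=> hz; have hz1 := (diskP z).1 hz.
rewrite (disk_cderiv g2_sum hz) (disk_psum g2_sum hz) (psum_euler hdm hz1).
have := psum_lin 1 1 (radius_ge_natM hdm) hdm hz1; rewrite !mul1r => <-.
by apply: eq_psum => n; rewrite !mul1r -natr1 mulrDl mul1r.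
Qed.

Lemma ode_b z : disk z -> (m%:R + 1) * (f z * g z) + z * cderiv (fun w => f w * g w) z =
  psum (fun k => (m%:R + 1 + k%:R) * b k) z.
Proof.
move=> hz; have hz1 := (diskP z).1 hz.
rewrite (disk_cderiv fg_sum hz) (disk_psum fg_sum hz) (psum_euler hb hz1).
have := psum_lin (m%:R + 1) 1 hb (radius_ge_natM hb) hz1; rewrite !mul1r => <-.
by apply: eq_psum => n; rewrite mul1r -mulrDl.
Qed.

Lemma ode3E z : disk z ->
  (z * cderiv g2 z + g2 z) + (m%:R + 1) * (f z * g z)
    + z * cderiv (fun w => f w * g w) z = psum ode_coef z.
Proof.
move=> hz; have hz1 := (diskP z).1 hz; rewrite -addrA ode_b // ode_dm //.
have r1 : radius_ge (fun k => k.+1%:R * dm k) 1.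
  have := radius_ge_D (radius_ge_natM hdm) hdm;
    rewrite (_ : (fun n => _) = (fun k => k.+1%:R * dm k)) //.
  by apply/funext => n; rewrite -natr1 mulrDl mul1r.
have r2 : radius_ge (fun k => (m%:R + 1 + k%:R) * b k) 1.
  have h3 : radius_ge (fun n => (m%:R + 1) * b n) 1.
    by apply: (radius_ge_le (K := N (m%:R + 1))) hb => n; rewrite Normc.normcM.
  have := radius_ge_D h3 (radius_ge_natM hb);
    rewrite (_ : (fun n => _) = (fun k => (m%:R + 1 + k%:R) * b k)) //.
  by apply/funext => n; rewrite -mulrDl.
have := psum_lin 1 1 r1 r2 hz1; rewrite !mul1r => <-.
by apply: eq_psum => n; rewrite !mul1r /dm addnC.
Qed.

Lemma ode2E z : disk z ->
  (z * cderiv g1 z - (m%:R - 1) * g1 z) + (m%:R + 1) * z ^+ m * (f z * g z)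
    + z ^+ m.+1 * cderiv (fun w => f w * g w) z = z ^+ m * psum ode_coef z.
Proof.
move=> hz; have hz1 := (diskP z).1 hz; rewrite -ode3E //.
(* The coefficients of [g1]. In degree n + m the operator z d/dz - (m-1) multiplies by n + 1,
   exactly as z d/dz + 1 does in degree [n] for [g2]; this is [E1]. *)
pose c n := if (n < m)%N then 0 else d n.
have cS : (fun n => c (n + m)%N) = dm.
  by apply/funext => n; rewrite /c ltnNge leq_addl.
have c_sum w : disk w -> power_sum c w (g1 w).
  move=> hw; have -> : g1 w = \sum_(i < m) c i * w ^+ i + w ^+ m * g2 w.
    by rewrite g2E // big1 ?add0r // => i _; rewrite /c ltn_ord mul0r.
  by apply: power_sum_split; rewrite cS; exact: g2_sum.
have hc := disk_radius c_sum.
have E1 : z * cderiv g1 z - (m%:R - 1) * g1 z = z ^+ m * (z * cderiv g2 z + g2 z).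
  rewrite [in RHS]ode_dm // (disk_cderiv c_sum hz) (disk_psum c_sum hz) (psum_euler hc hz1).
  have := psum_lin 1 (- (m%:R - 1)) (radius_ge_natM hc) hc hz1; rewrite mul1r mulNr => <-.
  rewrite (psum_split m _ hz1).
    rewrite big1 ?add0r => [|i _]; last by rewrite /c ltn_ord !mulr0 addr0 mul0r.
    congr (_ * _); apply: eq_psum => n.
    by rewrite -[c _]/((fun n => c (n + m)%N) n) cS natrD -natr1; ring.
  have h3 : radius_ge (fun n => - (m%:R - 1) * c n) 1.
    by apply: (radius_ge_le (K := N (- (m%:R - 1)))) hc => n; rewrite Normc.normcM.
  by have := radius_ge_D (radius_ge_natM hc) h3; under eq_fun do rewrite -[_%:R * _]mul1r.
have alg (L x y v : C) : L = z ^+ m * x ->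
    L + (m%:R + 1) * z ^+ m * y + z ^+ m.+1 * v = z ^+ m * (x + (m%:R + 1) * y + z * v).
  by move=> ->; rewrite exprS; ring.
exact: alg E1.
Qed.

Lemma ode_coef_eq0 k : ode_coef k = 0 <->
  d (m + k)%N = - ((m%:R + 1 + k%:R) / (k%:R + 1)) * b k.
Proof.
have k1 : k%:R + 1 != 0 :> C by rewrite natr1 pnatr_eq0.
rewrite /ode_coef -natr1; split=> [/eqP|->]; last by field.
rewrite addr_eq0 => /eqP h; apply: (mulfI k1); rewrite h; field.
exact: k1.
Qed.

(** The link between the operator and the differential equations: multiplying a coefficient of T g
    by m + k + 1 clears the denominator of [pcoef], and this factor is never 0. *)
Lemma ode_coef_pcoef k : ode_coef k = (m + k).+1%:R * (b k + pcoef m d k).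
Proof.
have k1 : (m + k).+1%:R != 0 :> C by rewrite pnatr_eq0.
rewrite /ode_coef /pcoef; have -> : m%:R + 1 + k%:R = (m + k).+1%:R :> C.
  by rewrite -natr1 natrD; ring.
by field.
Qed.

Lemma toeplitz0_coef : Hinfty f -> bergman g ->
  (forall z, disk z -> toeplitz (fun w => (w^*) ^+ m + f w) g z = 0) <->
  (forall k, ode_coef k = 0).
Proof.
move=> hf hg.
have hp := radius_ge_pcoef m hd.
have E z : disk z -> toeplitz (fun w => (w^*) ^+ m + f w) g z =
    psum (fun k => b k + pcoef m d k) z.
  move=> hz; rewrite (toeplitzE m hf f_sum hg g_sum hz) (disk_psum fg_sum hz).
  have := psum_lin 1 1 hb hp ((diskP z).1 hz); rewrite !mul1r => <-.
  by apply: eq_psum => n; rewrite !mul1r.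
split=> h.
- have h' := psum_zero (radius_ge_D hb hp) (fun z hz _ => etrans (esym (E z hz)) (h z hz)).
  by move=> k; rewrite ode_coef_pcoef h' mulr0.
- move=> z hz; rewrite E //; apply: psum0 => k.
  have := h k; rewrite ode_coef_pcoef => /eqP; rewrite mulf_eq0 pnatr_eq0 /=.
  by move/eqP.
Qed.

End Coefficients.

Theorem lemma3p1 (R : realType) (m : nat) (m_ge1 : (1 <= m)%N)
    (f g g0 g1 g2 : R[i] -> R[i]) (a d : nat -> R[i])
    (f_Hinfty : Hinfty f)
    (f_sum : forall z, disk z -> power_sum a z (f z))
    (g_bergman : bergman g)
    (g_sum : forall z, disk z -> power_sum d z (g z))
    (g0E : forall z, disk z -> g0 z = \sum_(k < m) d k * z ^+ k)
    (g1E : forall z, disk z -> g z = g0 z + g1 z)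
    (g2_analytic : analytic_on disk g2)
    (g2E : forall z, disk z -> g1 z = z ^+ m * g2 z) :
  [<-> (* (1) *)
       forall z, disk z ->
         toeplitz (fun w => (w^*) ^+ m + f w) g z = 0;
       (* (2) *)
       forall z, disk z ->
         (z * cderiv g1 z - (m%:R - 1) * g1 z)
           + (m%:R + 1) * z ^+ m * (f z * g z)
           + z ^+ m.+1 * cderiv (fun w => f w * g w) z = 0;
       (* (3) *)
       forall z, disk z ->
         (z * cderiv g2 z + g2 z) + (m%:R + 1) * (f z * g z)
           + z * cderiv (fun w => f w * g w) z = 0;
       (* (4) *)
       forall k : nat,
         d (m + k)%N = - ((m%:R + 1 + k%:R) / (k%:R + 1))
                         * \sum_(i < k.+1) a (k - i)%N * d i].
Proof.
have hT := toeplitz0_coef m f_sum g_sum f_Hinfty g_bergman.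
have h2 := ode2E f_sum g_sum g0E g1E g2_analytic g2E.
have h3 := ode3E f_sum g_sum g0E g1E g2_analytic g2E.
have hr := radius_ge_ode_coef m f_sum g_sum.
have h4 k := @ode_coef_eq0 R m a d k.
tfae.
- by move=> /hT h z hz; rewrite h2 // psum0 ?mulr0.
(* Dividing by z^m is possible off the origin only, which is enough to make every coefficient
   vanish. *)
- move=> h z hz; rewrite h3 //; apply: psum0; apply: psum_zero => // w hw w0.
  apply: (mulfI (expf_neq0 m w0)); rewrite mulr0 -h2 //; exact: h.
- move=> h k; apply/h4; apply: psum_zero => // w hw _.
  by rewrite -h3 // h.
- by move=> h; apply/hT => k; apply/h4.
Qed.
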